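(* There is an algorithm that, given an OTG $G$ with $n\ge 3$ vertices, computes the $H$-force number $h(G)$ and a minimum $H$-force set of $G$ in time $O(n^3)$.
   Context: All graphs are finite and simple. A graph $G$ with $n$ vertices is an OTG if $d(u)+d(v)\geq n$ for every pair of distinct nonadjacent vertices $u,v$; for $n\ge3$ such a graph is Hamiltonian by Ore's theorem. For $X\subseteq V(G)$, an $X$-cycle is a cycle of $G$ containing all vertices of $X$. For a Hamiltonian graph $G$, a nonempty $X\subseteq V(G)$ is an $H$-force set if every $X$-cycle of $G$ is Hamiltonian; $h(G)$ is the smallest cardinality of an $H$-force set; a minimum $H$-force set is an $H$-force set of cardinality $h(G)$. *)

(* Defs.v *)
From mathcomp Require Import all_boot.

Set Implicit Arguments.
Unset Strict Implicit.
Unset Printing Implicit Defensive.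

(* A simple graph on the vertex type [T] is a symmetric irreflexive [e : rel T];
   both properties are hypotheses wherever they are needed. *)
Section Graphs.

Variables (T : finType) (e : rel T).

Definition degree (u : T) : nat := #|[set v | e u v]|.

Definition OTG : Prop :=
  forall u v : T, u != v -> ~~ e u v -> #|T| <= degree u + degree v.

(* The cyclic sequence of the distinct vertices of a cycle.  The bound on the
   size is needed: in path.v, [::], [:: u] when e u u, and [:: u; v] when e u v
   and e v u, are also cycles. *)
Definition graph_cycle (c : seq T) : bool :=
  [&& 2 < size c, cycle e c & uniq c].

Definition Xcycle (X : {set T}) (c : seq T) : Prop :=
  graph_cycle c /\ {subset X <= c}.

Definition hamiltonian_cycle (c : seq T) : Prop :=
  graph_cycle c /\ forall v : T, v \in c.

(* Meant for Hamiltonian graphs only; OTGs with at least 3 vertices are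
   Hamiltonian by Ore's theorem. *)
Definition Hforce_set (X : {set T}) : Prop :=
  X != set0 /\ forall c : seq T, Xcycle X c -> hamiltonian_cycle c.

(* [Hforce_number h] states that h = h(G). *)
Definition Hforce_number (h : nat) : Prop :=
  (exists2 X : {set T}, Hforce_set X & #|X| = h) /\
  (forall X : {set T}, Hforce_set X -> h <= #|X|).

Definition minimum_Hforce_set (X : {set T}) : Prop :=
  Hforce_set X /\ Hforce_number #|X|.

End Graphs.

(* Structured word-RAM programs.  A fixed program mentions finitely many
   registers; the memory is reached by indirect addressing only. *)
Inductive binop := Add | Sub | Mul.

Inductive cmd :=
  | Skip
  | Const (r k : nat)
  | Op (o : binop) (r a b : nat)
  | Read (r a : nat)
  | Write (a r : nat)
  | Seq (p q : cmd)
  | If (r : nat) (p q : cmd)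
  | While (r : nat) (p : cmd).

Record state := State { regs : nat -> nat; cells : nat -> nat }.

Definition set_reg (s : state) (r v : nat) : state :=
  State [eta regs s with r |-> v] (cells s).

Definition set_mem (s : state) (a v : nat) : state :=
  State (regs s) [eta cells s with a |-> v].

Definition eval_op (o : binop) : nat -> nat -> nat :=
  match o with Add => addn | Sub => subn | Mul => muln end.

(* [exec W p s t s']: with words ranging over 0, ..., W - 1, the program p
   started in s halts in s' after t steps.  Every instruction and every test
   costs one step.  A program that computes a value that does not fit in a word
   is stuck, so unit cost is not an artefact of arithmetic on huge numbers. *)
Inductive exec (W : nat) : cmd -> state -> nat -> state -> Prop :=
  | ExecSkip s : exec W Skip s 0 s
  | ExecConst s r k : k < W ->
      exec W (Const r k) s 1 (set_reg s r k)
  | ExecOp s o r a b : eval_op o (regs s a) (regs s b) < W ->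
      exec W (Op o r a b) s 1 (set_reg s r (eval_op o (regs s a) (regs s b)))
  | ExecRead s r a :
      exec W (Read r a) s 1 (set_reg s r (cells s (regs s a)))
  | ExecWrite s a r :
      exec W (Write a r) s 1 (set_mem s (regs s a) (regs s r))
  | ExecSeq p q s1 s2 s3 t u : exec W p s1 t s2 -> exec W q s2 u s3 ->
      exec W (Seq p q) s1 (t + u) s3
  | ExecIfTrue r p q s s' t : regs s r != 0 -> exec W p s t s' ->
      exec W (If r p q) s t.+1 s'
  | ExecIfFalse r p q s s' t : regs s r = 0 -> exec W q s t s' ->
      exec W (If r p q) s t.+1 s'
  | ExecWhileTrue r p s1 s2 s3 t u : regs s1 r != 0 ->
      exec W p s1 t s2 -> exec W (While r p) s2 u s3 ->
      exec W (While r p) s1 (t + u).+1 s3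
  | ExecWhileFalse r p s : regs s r = 0 ->
      exec W (While r p) s 1 s.

Lemma exec_det W p s t1 s1 t2 s2 :
  exec W p s t1 s1 -> exec W p s t2 s2 -> t1 = t2 /\ s1 = s2.
Proof.
move=> E; elim: E t2 s2 => {p s t1 s1}
  [s|s r k _|s o r a b _|s r a|s a r|p q s1 s2 s3 t u _ IHp _ IHq
  |r p q s s' t r0 _ IH|r p q s s' t r0 _ IH
  |r p s1 s2 s3 t u r0 _ IHp _ IHw|r p s r0] t' s'' E;
  inversion E; subst => //.
all: try by match goal with H : is_true (regs _ _ != 0), H' : regs _ _ = 0 |- _ =>
  rewrite H' eqxx in H end.
- match goal with Hp : exec W p _ _ _, Hq : exec W q _ _ _ |- _ =>
    by have [? ?] := IHp _ _ Hp; subst; have [-> ->] := IHq _ _ Hq end.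
- by match goal with Hp : exec W p _ _ _ |- _ => have [-> ->] := IH _ _ Hp end.
- by match goal with Hq : exec W q _ _ _ |- _ => have [-> ->] := IH _ _ Hq end.
- match goal with Hp : exec W p _ _ _, Hq : exec W (While _ _) _ _ _ |- _ =>
    by have [? ?] := IHp _ _ Hp; subst; have [-> ->] := IHw _ _ Hq end.
Qed.

(* Register 0 holds n, and cells 0, ..., n^2 - 1 hold the adjacency matrix in
   row-major order; everything else is 0. *)
Definition input (n : nat) (e : rel 'I_n) : state :=
  State [eta (fun=> 0) with 0 |-> n]
    (fun k => [exists i : 'I_n, exists j : 'I_n, (k == i * n + j) && e i j]).

(* Register 0 holds h, and cells n^2, ..., n^2 + n - 1 hold the characteristic
   vector of X; the rest of the state is irrelevant. *)
Definition output (n : nat) (s : state) (h : nat) (X : {set 'I_n}) : Prop :=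
  regs s 0 = h /\ forall i : 'I_n, cells s (n * n + i) = (i \in X).

(* Main.v *)
Require Import Defs.
From mathcomp Require Import all_boot zify.

Set Implicit Arguments.
Unset Strict Implicit.
Unset Printing Implicit Defensive.

(* X is an H-force set if and only if it meets the complement of every
   non-Hamiltonian cycle.  If all degrees are at most 2 (the graph is K_3 or C_4)
   every cycle is Hamiltonian and h = 1.  Otherwise G - v satisfies Ore's
   condition up to 1, and a graph D with d(x) + d(y) >= |D| - 1 for nonadjacent
   x, y is Hamiltonian unless it has a cut vertex or a stable set of more than
   |D| / 2 vertices.  So either every G - v is Hamiltonian and h = n, or G has a
   cut X of two vertices, its complement is a minimum H-force set and h = n - 2,
   or G has a stable set S of n / 2 vertices, completely joined to the rest, S is
   a minimum H-force set and h = n / 2.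
   In both exceptional cases the cut is, for a suitable vertex u, the set of the
   neighbours of u that have another neighbour outside N(u); for each u this set
   is computed and tested in time O(n^2). *)

(** Ore's inequality is tight in both exceptional graphs, which makes them rigid: a vertex on one
    side of the cut is adjacent to everything except the other side, a vertex of [S] to exactly the
    complement of [S]. This is why the neighbourhood of a single vertex reveals the whole structure
    and no pairs of vertices have to be tried. A cycle that misses exactly one vertex puts this
    vertex into every H-force set. For a cut this applies to all vertices off the cut, because a
    second obstruction would make the graph C_4; hence the separate treatment of degrees at most 2.
    For a stable set the argument differs: in K_{m,m} no cycle misses exactly one vertex, and the
    bound comes from cycles that miss one vertex in each part. The dichotomy comes from the usual
    crossing count along a spanning path. With the condition weakened by one the count is tight
    instead of contradictory, so that the neighbours of one end determine those of the other. *)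

(** * Cyclic and linear sequences *)

(* lia is exponential in the boolean hypotheses of the context. *)
Ltac nat_lia :=
  repeat match goal with
  | H : ?P |- _ =>
    lazymatch P with
    | is_true (leq _ _) => fail
    | @eq nat _ _ => fail
    | _ => clear H
    end
  end; lia.

Section Lists.

Variables (T : eqType) (e : rel T) (x0 : T).
Implicit Types p q : seq T.

Lemma sorted_cat_nonempty p q : p != [::] -> q != [::] ->
  sorted e (p ++ q) = [&& sorted e p, e (last x0 p) (head x0 q) & sorted e q].
Proof. by case: p q => [|x p] [|y q] //= _ _; rewrite cat_path. Qed.

Lemma cycle_sorted p : p != [::] ->
  cycle e p = sorted e p && e (last x0 p) (head x0 p).
Proof. by case: p => //= x p _; rewrite rcons_path. Qed.

Lemma head_rev p : head x0 (rev p) = last x0 p.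
Proof. by case/lastP: p => // p x; rewrite rev_rcons last_rcons. Qed.

Lemma last_rev p : last x0 (rev p) = head x0 p.
Proof. by rewrite -{2}[p]revK head_rev. Qed.

Lemma rev_eq_nil p : (rev p == [::]) = (p == [::]).
Proof. by rewrite -!size_eq0 size_rev. Qed.

Lemma head_cat_nonempty p q : p != [::] -> head x0 (p ++ q) = head x0 p.
Proof. by case: p. Qed.

Lemma last_cat_nonempty p q : q != [::] -> last x0 (p ++ q) = last x0 q.
Proof. by case: q => // y q _; rewrite last_cat. Qed.

Lemma cat_eq_nil p q : (p ++ q == [::]) = (p == [::]) && (q == [::]).
Proof. by case: p. Qed.

Lemma split2 p i : i.+1 < size p -> exists q r,
  [/\ p = q ++ r, q != [::], r != [::], last x0 q = nth x0 p i
    & head x0 r = nth x0 p i.+1].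
Proof.
move=> lt_i; exists (take i.+1 p), (drop i.+1 p); split.
- by rewrite cat_take_drop.
- by rewrite -size_eq0 size_takel // ltnW.
- by rewrite -size_eq0 size_drop; nat_lia.
- by rewrite -nth_last nth_take size_takel // ltnW.
- by rewrite -nth0 nth_drop addn0.
Qed.

Lemma split3 p i j : i < j -> j.+1 < size p -> exists q r s,
  [/\ p = q ++ r ++ s, [/\ q != [::], r != [::] & s != [::]],
      last x0 q = nth x0 p i, head x0 r = nth x0 p i.+1
    & last x0 r = nth x0 p j /\ head x0 s = nth x0 p j.+1].
Proof.
move=> lt_ij lt_j.
exists (take i.+1 p), (drop i.+1 (take j.+1 p)), (drop j.+1 p).
have sz_t: size (take j.+1 p) = j.+1 by rewrite size_takel // ltnW.
have sz_d: size (drop i.+1 (take j.+1 p)) = j - i by rewrite size_drop sz_t subSS.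
split.
- have -> : take i.+1 p = take i.+1 (take j.+1 p) by rewrite take_takel // ltnW.
  by rewrite catA cat_take_drop cat_take_drop.
- split; first by rewrite -size_eq0 size_takel //; nat_lia.
    by rewrite -size_eq0 sz_d; nat_lia.
  by rewrite -size_eq0 size_drop; nat_lia.
- by rewrite -nth_last nth_take size_takel //; nat_lia.
- by rewrite -nth0 nth_drop addn0 nth_take.
- split; last by rewrite -nth0 nth_drop addn0.
  by rewrite -nth_last sz_d nth_drop nth_take; [congr nth; nat_lia | nat_lia].
Qed.

Hypothesis e_sym : symmetric e.

Lemma sorted_rev_sym p : sorted e (rev p) = sorted e p.
Proof. by rewrite rev_sorted; apply: eq_sorted => x y; rewrite e_sym. Qed.

(* The path p_0 ... p_i p_(i+1) ... p_m closes up as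
   p_0 ... p_i p_m ... p_(i+1) p_0. *)
Lemma crossing_cycle p i : sorted e p -> i.+1 < size p ->
    e (nth x0 p 0) (nth x0 p i.+1) -> e (nth x0 p i) (last x0 p) ->
  exists2 c, cycle e c & perm_eq c p.
Proof.
move=> sp /split2 [q [r [p_eq q0 r0 <- <-]]]; move: sp; rewrite {p}p_eq.
rewrite sorted_cat_nonempty // => /and3P[sq _ sr].
rewrite nth0 head_cat_nonempty // last_cat_nonempty // => e1 e2.
exists (q ++ rev r); last by rewrite perm_cat2l perm_rev.
have r'0 : rev r != [::] by rewrite rev_eq_nil.
rewrite cycle_sorted ?cat_eq_nil ?negb_and ?q0 // sorted_cat_nonempty //.
rewrite sorted_rev_sym sq sr head_rev e2 head_cat_nonempty //.
by rewrite last_cat_nonempty // last_rev e_sym e1.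
Qed.

End Lists.

(** * Hamiltonicity when Ore's condition holds up to one *)

Section Dichotomy.

Variables (T : finType) (e : rel T).
Hypotheses (e_sym : symmetric e) (e_irr : irreflexive e).

Definition degree_in (D : {set T}) (x : T) : nat := #|[set y in D | e x y]|.

Definition stable_set (S : {set T}) : Prop := {in S &, forall x y, ~~ e x y}.

Lemma degree_in_nth (D : {set T}) (x0 x : T) (p : seq T) :
    uniq p -> {subset p <= D} -> (forall y, y \in D -> e x y -> y \in p) ->
  degree_in D x = \sum_(i < size p) e x (nth x0 p i).
Proof.
move=> uniq_p pD Np; rewrite -(big_mkord xpredT (fun i => e x (nth x0 p i) : nat)).
rewrite -(big_nth x0 xpredT (fun y => e x y : nat)).
have -> : \sum_(y <- p) (e x y : nat) = size (filter (e x) p).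
  by rewrite size_filter -sum1_count [RHS]big_mkcond; apply: eq_bigr => y _; case: (e x y).
rewrite -(card_uniqP (filter_uniq _ uniq_p)) /degree_in.
apply: eq_card => y; rewrite !inE mem_filter andbC.
by case exy: (e x y) => //=; apply/idP/idP => [/Np|/pD]; auto.
Qed.

Section Spanning.

Variable D : {set T}.
Hypothesis ore : forall x y, x \in D -> y \in D -> x != y -> ~~ e x y ->
  #|D| <= (degree_in D x + degree_in D y).+1.

(** Term [i] pairs the two chords that would close up the path at [i]: the value 2 is a crossing.
    The shift by one loses nothing, as no vertex is adjacent to itself. *)
Lemma degree_ends (x0 : T) (p : seq T) :
    uniq p -> {subset p <= D} -> 1 < size p ->
    (forall y, y \in D -> e (nth x0 p 0) y -> y \in p) ->
    (forall y, y \in D -> e (last x0 p) y -> y \in p) ->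
    ~~ e (nth x0 p 0) (last x0 p) ->
  degree_in D (nth x0 p 0) + degree_in D (last x0 p) =
  \sum_(i < (size p).-1) (e (nth x0 p 0) (nth x0 p i.+1) + e (nth x0 p i) (last x0 p)).
Proof.
move=> up pD p1 N0 Nl nadj; rewrite big_split /=.
rewrite (degree_in_nth x0 up pD N0) (degree_in_nth x0 up pD Nl).
have ->: size p = (size p).-1.+1 by nat_lia.
rewrite big_ord_recl e_irr /= add0n; congr (_ + _).
by rewrite big_ord_recr /= nth_last e_irr addn0; apply: eq_bigr => i _; rewrite e_sym.
Qed.

(** If an end of [p] has a neighbour off [p], append it. Otherwise the vertices of [p] span a cycle,
    since without a crossing the degrees of the ends sum to less than |D| - 1; opening this cycle at
    a neighbour of an outside vertex [z] makes room for [z]. *)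
Lemma path_extend (p : seq T) :
    p != [::] -> sorted e p -> uniq p -> {subset p <= D} -> size p < #|D| ->
  exists q, [/\ sorted e q, uniq q, {subset q <= D} & size q = (size p).+1].
Proof.
case: p => // x p0 _; set p := x :: p0 => sp up pD ltp.
have [/existsP[y /and3P[yD yp xy]]|] :=
    boolP [exists y, [&& y \in D, y \notin p & e x y]].
  exists (y :: p); split=> //; first by rewrite /= e_sym xy.
    by rewrite cons_uniq yp.
  by move=> z; rewrite inE => /predU1P[->|/pD].
rewrite negb_exists => /forallP Nx0.
have Nx y : y \in D -> e x y -> y \in p.
  by move=> yD xy; have := Nx0 y; rewrite yD xy andbT /= negbK.
have [/existsP[y /and3P[yD yp xy]]|] :=
    boolP [exists y, [&& y \in D, y \notin p & e (last x p) y]].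
  exists (rcons p y); split; last by rewrite size_rcons.
  - by rewrite /= rcons_path; apply/andP.
  - by rewrite rcons_uniq yp.
  - by move=> z; rewrite mem_rcons inE => /predU1P[->|/pD].
rewrite negb_exists => /forallP Nl0.
have Nl y : y \in D -> e (last x p) y -> y \in p.
  by move=> yD ly; have := Nl0 y; rewrite yD ly andbT /= negbK.
have degx: degree_in D x <= (size p).-1.
  rewrite (degree_in_nth x up pD Nx) /= big_ord_recl /= e_irr add0n.
  by rewrite -[leqRHS]card_ord -sum1_card leq_sum // => i _; case: (e _ _).
have [z zD zp] : exists2 z, z \in D & z \notin p.
  apply/subsetPn; apply: contraTN ltp => /subset_leq_card.
  by rewrite (card_uniqP up) leqNgt.
have xz: ~~ e x z by apply: contraNN zp; apply: Nx.
have xD: x \in D by apply: pD; rewrite mem_head.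
have xDz: x != z by apply: contraNneq zp => <-; rewrite mem_head.
(* If there were none, [z] would have at most |D| - |p| - 1 neighbours in [D]; with at most |p| - 1
   for [x] this is one short of the condition. *)
have [y yp zy] : exists2 y, y \in p & e z y.
  apply/hasP; apply: contraT => /hasPn nz.
  have := ore xD zD xDz xz.
  have : degree_in D z <= #|D :\: [set y in z :: p]|.
    apply: subset_leq_card; apply/subsetP => y; rewrite !inE => /andP[-> zy].
    rewrite andbT negb_or; apply/andP; split.
      by apply: contraTneq zy => ->; rewrite e_irr.
    by apply: contraTN zy => /nz.
  have := cardsID [set y in z :: p] D.
  have -> : D :&: [set y in z :: p] = [set y in z :: p].
    by apply/setIidPr/subsetP => y; rewrite !inE => /predU1P[->|/pD].
  rewrite cardsE (card_uniqP _) /=; last by rewrite zp.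
  move: degx; rewrite /=; nat_lia.
have [c cyc pc] : exists2 c, cycle e c & perm_eq c p.
  have [xl|xl] := boolP (e x (last x p)).
    by exists p => //; rewrite /= rcons_path e_sym [path _ _ _]sp.
  have sz_p: 1 < size p.
    move: yp zy xz; rewrite /p; case: (p0) => //=.
    by rewrite inE => /eqP ->; rewrite e_sym => ->.
  have xDl: x != last x p.
    by move: sz_p up; rewrite /p; case: (p0) => //= a r _ /andP[xr _];
       apply: contraNneq xr => ->; apply: mem_last.
  have lD: last x p \in D by apply: pD; apply: (mem_last x p0).
  have := ore xD lD xDl xl.
  have -> := @degree_ends x p up pD sz_p Nx Nl xl.
  have [/existsP[i /andP[e1 e2]] _|] := boolP [exists i : 'I_(size p).-1,
      e (nth x p 0) (nth x p i.+1) && e (nth x p i) (last x p)].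
    have lt_i: i.+1 < size p by rewrite -ltn_predRL ltn_ord.
    exact: (crossing_cycle e_sym sp lt_i e1 e2).
  rewrite negb_exists => /forallP nx.
  have : \sum_(i < (size p).-1)
     (e (nth x p 0) (nth x p i.+1) + e (nth x p i) (last x p)) <= (size p).-1.
    rewrite -[leqRHS]card_ord -sum1_card leq_sum // => i _.
    by have := nx i; case: (e _ _); case: (e _ _).
  rewrite -ltnS => le1 le2; have := leq_trans le2 le1.
  have -> : (size p).-1.+1 = size p by apply: prednK; apply: ltnW.
  by rewrite leqNgt ltp.
have yc: y \in c by rewrite (perm_mem pc).
have [i c' rot_c] := rot_to yc.
have pc' : perm_eq (y :: c') p.
  by rewrite -rot_c; apply: perm_trans pc; rewrite perm_rot.
exists (z :: y :: c'); split; last by rewrite -(perm_size pc').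
- have : cycle e (rot i c) by rewrite rot_cycle.
  by rewrite rot_c /= rcons_path zy => /andP[].
- by rewrite cons_uniq (perm_mem pc') zp (perm_uniq pc').
- by move=> t; rewrite inE (perm_mem pc') => /predU1P[->|/pD].
Qed.

Lemma spanning_path : 0 < #|D| ->
  exists p, [/\ sorted e p, uniq p, p =i D & size p = #|D|].
Proof.
move=> D0.
have /(_ #|D| D0 (leqnn _)) [p [sp up pD szp]] : forall k, 0 < k -> k <= #|D| ->
    exists p, [/\ sorted e p, uniq p, {subset p <= D} & size p = k].
  elim=> // -[_ _ _|k IH _ lek].
    have [x xD] := card_gt0P D0.
    by exists [:: x]; split=> // y; rewrite inE => /eqP ->.
  have [p [sp up pD szp]] := IH isT (ltnW lek).
  rewrite -szp; apply: path_extend => //; last by rewrite szp.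
  by rewrite -size_eq0 szp.
exists p; split=> //.
have sub_pD: p \subset D by apply/subsetP.
by apply/subset_cardP; rewrite ?(card_uniqP up).
Qed.

End Spanning.

Lemma sum_all_ones (m : nat) (F : 'I_m -> nat) :
  m <= \sum_(i < m) F i -> (forall i, F i <= 1) -> forall i, F i = 1.
Proof.
move=> le_mF F1 i; apply/eqP; rewrite eqn_leq F1 lt0n; apply: contraTneq le_mF => Fi.
rewrite -ltnNge (bigD1 i) //= Fi add0n -[ltnRHS]card_ord (cardD1 i) inE add1n ltnS.
rewrite -sum1_card big_mkcond [leqRHS]big_mkcond leq_sum // => j _; rewrite !inE andbT.
by case: (j != i).
Qed.

(* Otherwise an adjacent pair of successors of neighbours of k, or of k and such
   a successor, reroutes c through k. *)
Lemma stable_successors (k : T) (c : seq T) :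
    cycle e c -> (forall c', cycle e c' -> ~~ perm_eq c' (k :: c)) ->
  stable_set (k |: [set nth k c j.+1 | j : 'I_(size c).-1 & e k (nth k c j)]).
Proof.
move=> cyc noham.
have c0 (q r : seq T) : c = q ++ r -> q != [::] -> c != [::].
  by move=> -> q0; rewrite cat_eq_nil (negPf q0).
have kN j : j.+1 < size c -> e k (nth k c j) -> ~~ e k (nth k c j.+1).
  move=> lt_j; have [q [r [c_eq q0 r0 <- <-]]] := split2 k lt_j => e1.
  apply/negP => e2; have := cyc; rewrite (cycle_sorted _ k (c0 _ _ c_eq q0)) c_eq.
  rewrite (sorted_cat_nonempty _ k) // head_cat_nonempty // last_cat_nonempty //.
  case/andP=> /and3P[sq _ sr] e3.
  suff : cycle e (k :: r ++ q) by move/noham; rewrite c_eq perm_cons perm_catC perm_refl.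
  rewrite (cycle_sorted _ k) // -cat1s (sorted_cat_nonempty _ k) ?cat_eq_nil ?negb_and ?r0 //.
  rewrite (sorted_cat_nonempty _ k) // sq sr e3 head_cat_nonempty //= e2.
  by rewrite last_cat_nonempty // e_sym e1.
have NN i j : i < j -> j.+1 < size c -> e k (nth k c i) -> e k (nth k c j) ->
    ~~ e (nth k c i.+1) (nth k c j.+1).
  move=> lt_ij lt_j.
  have [q [r [s [c_eq [q0 r0 s0] <- <- [<- <-]]]]] := split3 k lt_ij lt_j => e1 e2.
  apply/negP => e3; have := cyc; rewrite (cycle_sorted _ k (c0 _ _ c_eq q0)) c_eq.
  have rs0 : r ++ s != [::] by rewrite cat_eq_nil (negPf r0).
  have sq0 : s ++ q != [::] by rewrite cat_eq_nil (negPf s0).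
  have r'0 : rev r != [::] by rewrite rev_eq_nil.
  rewrite !(sorted_cat_nonempty _ k) // !head_cat_nonempty // !last_cat_nonempty //.
  case/andP=> /and5P[sq _ sr _ ss] e4.
  (* New edges: [k] to the end of [r], the start of [r] to the start of [s], the end of [q] to [k].
     From [s] to [q] runs the closing edge of [c]. *)
  suff : cycle e (k :: rev r ++ s ++ q).
    move/noham/negP; apply; rewrite c_eq perm_cons; apply/permP => a.
    by rewrite !count_cat count_rev addnA addnC.
  rewrite (cycle_sorted _ k) // -cat1s.
  rewrite !(sorted_cat_nonempty _ k) ?cat_eq_nil ?negb_and ?r'0 ?s0 //.
  rewrite (sorted_rev_sym e_sym) sq sr ss e4 !head_cat_nonempty // head_rev last_rev.
  by rewrite !last_cat_nonempty //= ?cat_eq_nil ?negb_and ?r'0 ?s0 //= e2 e3 e_sym e1.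
have lt_ord (i : 'I_(size c).-1) : i.+1 < size c by rewrite -ltn_predRL ltn_ord.
move=> x y /setU1P[->|/imsetP[i + ->]] /setU1P[->|/imsetP[j + ->]]; rewrite ?e_irr ?inE //.
- exact: kN.
- by move=> ki; rewrite e_sym; apply: kN.
move=> ki kj; have [ij|ij|->] := ltngtP i j; last by rewrite e_irr.
- exact: NN.
- by rewrite e_sym; apply: NN.
Qed.

(* The junction edges p_i p_(j+1), p_m p_j and p_(i+1) p_0 close up p. *)
Lemma double_crossing_cycle (x0 : T) (p : seq T) (i j : nat) :
    sorted e p -> i < j -> j.+1 < size p ->
    e (nth x0 p i) (nth x0 p j.+1) -> e (nth x0 p 0) (nth x0 p i.+1) ->
    e (nth x0 p j) (last x0 p) ->
  exists2 c, cycle e c & perm_eq c p.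
Proof.
move=> sp lt_ij lt_j.
have [q [r [s [p_eq [q0 r0 s0] <- <- [<- <-]]]]] := split3 x0 lt_ij lt_j.
have rs0 : r ++ s != [::] by rewrite cat_eq_nil (negPf r0).
have r'0 : rev r != [::] by rewrite rev_eq_nil.
have sr'0 : s ++ rev r != [::] by rewrite cat_eq_nil (negPf s0).
move: sp; rewrite nth0 p_eq head_cat_nonempty // !last_cat_nonempty //.
rewrite !(sorted_cat_nonempty _ x0) // => /and5P[sq _ sr _ ss] e1 e2 e3.
exists (q ++ s ++ rev r).
  rewrite (cycle_sorted _ x0) ?cat_eq_nil ?(negPf q0) //.
  rewrite !(sorted_cat_nonempty _ x0) // !head_cat_nonempty // !last_cat_nonempty //.
  by rewrite (sorted_rev_sym e_sym) sq sr ss head_rev last_rev e1 (e_sym (last x0 s)) e3 e_sym e2.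
by rewrite perm_cat2l perm_catC perm_cat2r perm_rev.
Qed.

(** When no cycle spans [D], the ends of a spanning path [f 0], ..., [f N] have degree sum exactly
    [N]. If the neighbours of [f 0] on the path have a gap, the last vertex of the gap is missed by
    a cycle through all others and yields the stable set. If they form an initial segment, its last
    vertex is the cut vertex. *)
Lemma hamiltonian_dichotomy (D : {set T}) :
    2 < #|D| ->
    (forall x y, x \in D -> y \in D -> x != y -> ~~ e x y ->
       #|D| <= (degree_in D x + degree_in D y).+1) ->
  [\/ exists2 c, graph_cycle e c & c =i D,
      exists x (A B : {set T}), [/\ x \in D, A != set0, B != set0,
        D :\ x = A :|: B & [disjoint A & B] /\ {in A & B, forall a b, ~~ e a b}]
    | exists2 S : {set T}, S \subset D & stable_set S /\ #|D| < 2 * #|S| ].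
Proof.
move=> D3 ore; have [|p [sp up pD szp]] := spanning_path ore; first by nat_lia.
have [/existsP[c /andP[cyc pc]]|] :=
    boolP [exists c : #|D|.-tuple T, cycle e c && perm_eq c p].
  apply: Or31; exists c => [|x]; last by rewrite (perm_mem pc) pD.
  by rewrite /graph_cycle cyc (perm_uniq pc) up size_tuple D3.
rewrite negb_exists => /forallP noham0.
have noham c : cycle e c -> perm_eq c p -> False.
  move=> cyc pc; have szc : size c == #|D| by rewrite (perm_size pc) szp.
  by have := noham0 (Tuple szc); rewrite /= cyc pc.
have [x0 _] : exists x0, x0 \in D by apply/card_gt0P; nat_lia.
have sub_pD : {subset p <= D} by move=> x; rewrite pD.
have nbr x y : y \in D -> e x y -> y \in p by rewrite pD.
pose f := nth x0 p; pose N := (size p).-1.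
have lastf : last x0 p = f N by rewrite -nth_last.
have f_eq i j : i < size p -> j < size p -> (f i == f j) = (i == j).
  by move=> *; rewrite nth_uniq.
have fD i : i < size p -> f i \in D by move=> lt_i; rewrite -pD mem_nth.
have sp1 : 1 < size p by rewrite szp; nat_lia.
have pn0 : p != [::] by apply: contraTneq sp1 => ->.
have nadj0N : ~~ e (f 0) (f N).
  apply/negP => adj; apply: (noham p) => //.
  by rewrite (cycle_sorted _ x0) // sp lastf -nth0 e_sym.
have nocross i : i < N -> ~~ (e (f 0) (f i.+1) && e (f i) (f N)).
  move=> lt_i; apply/negP => /andP[e1 e2].
  have lt_i' : i.+1 < size p by rewrite -ltn_predRL.
  by have [|c] := @crossing_cycle _ e x0 e_sym p i sp lt_i' e1; rewrite ?lastf //; apply: noham.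
have D0N : f 0 != f N by rewrite f_eq //; nat_lia.
have [f0D fND] : f 0 \in D /\ f N \in D by split; apply: fD; nat_lia.
have szN : size p = N.+1 by rewrite prednK // ltnW.
have cardD : #|D| = N.+1 by rewrite -szp.
rewrite cardD in ore D3 *; have sum1 := ore _ _ f0D fND D0N nadj0N.
have sum2 : degree_in D (f 0) + degree_in D (f N) =
    \sum_(i < N) (e (f 0) (f i.+1) + e (f i) (f N)).
  by rewrite -lastf (degree_ends up sub_pD) ?lastf //; apply: nbr.
(* [N] terms of value at most 1 have sum at least [N], so each of them is 1. *)
have {nocross} exact i : i < N -> e (f i) (f N) = ~~ e (f 0) (f i.+1).
  move=> lt_i; have := @sum_all_ones N (fun i => e (f 0) (f i.+1) + e (f i) (f N)).
  rewrite -sum2 => /(_ _ _ (Ordinal lt_i)) /= E.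
  suff : e (f 0) (f i.+1) + e (f i) (f N) = 1 by case: (e _ _); case: (e _ _).
  apply: E => [|j]; first by nat_lia.
  by have := nocross j (ltn_ord j); case: (e _ _); case: (e _ _).
have sumN : degree_in D (f 0) + degree_in D (f N) = N.
  rewrite sum2 -[RHS]card_ord -sum1_card; apply: eq_bigr => i _.
  by rewrite exact //; case: (e _ _).
clear sum2.
have adj01 : e (f 0) (f 1).
  have lt0 : 1 < size p by [].
  have [q [r [p_eq q0 r0 eq0 eq1]]] := split2 x0 lt0.
  by move: sp; rewrite p_eq (sorted_cat_nonempty _ x0) // eq0 eq1 => /and3P[].
have [/existsP[[i lt_iN] /= /and3P[i0 ei ei1]]|] :=
    boolP [exists i : 'I_N, [&& 0 < i, ~~ e (f 0) (f i) & e (f 0) (f i.+1)]].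
  apply: Or33; pose k := f i.
  have lt_i : i.+1 < size p by rewrite -ltn_predRL.
  have ek0 : ~~ e k (f 0) by rewrite e_sym.
  have ekN : ~~ e k (f N) by rewrite exact // ei1.
  have eN : e (f i.-1) (f N).
    rewrite exact; first by rewrite prednK.
    exact: leq_ltn_trans (leq_pred i) lt_iN.
  have kD : k \in D by apply: fD; nat_lia.
  (* [k] is adjacent to neither end: add up the condition for [k] with each of them. *)
  have degk : N <= 2 * degree_in D k.
    have kf0 : k != f 0 by rewrite f_eq //; nat_lia.
    have kfN : k != f N by rewrite f_eq //; nat_lia.
    have := ore _ _ kD f0D kf0 ek0; have := ore _ _ kD fND kfN ekN.
    by move: sumN; nat_lia.
  have le_i : i <= size p by rewrite -ltnS ltnW // ltnW.
  (* From [f (i-1)] down to [f 0], over to [f (i+1)] and on to [f N], which is adjacent to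
     [f (i-1)]: only [k] is missed. *)
  pose c := rev (take i p) ++ drop i.+1 p.
  have d0 : drop i.+1 p != [::] by rewrite -size_eq0 size_drop szN subSS subn_eq0 -ltnNge.
  have t0 : rev (take i p) != [::]
    by rewrite rev_eq_nil -size_eq0 size_takel -?lt0n // szN; nat_lia.
  have pc : perm_eq (k :: c) p.
    rewrite -[X in perm_eq _ X](cat_take_drop i) (drop_nth x0); last by nat_lia.
    by rewrite -cat1s /c perm_catCA perm_cat // perm_rev.
  have cyc : cycle e c.
    rewrite (cycle_sorted _ x0) ?cat_eq_nil ?(negPf t0) // (sorted_cat_nonempty _ x0) //.
    rewrite (sorted_rev_sym e_sym) take_sorted // drop_sorted // last_rev head_cat_nonempty //.
    rewrite last_cat_nonempty // head_rev.
    have -> : head x0 (drop i.+1 p) = f i.+1 by rewrite -nth0 nth_drop addn0.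
    have -> : head x0 (take i p) = f 0 by rewrite -nth0 nth_take.
    have -> : last x0 (take i p) = f i.-1.
      by rewrite -nth_last size_takel // nth_take // ltn_predL.
    have -> : last x0 (drop i.+1 p) = f N.
      by rewrite -lastf -[in RHS](cat_take_drop i.+1 p) last_cat_nonempty.
    by rewrite ei1 e_sym eN.
  have szc : size c = N by have := perm_size pc; rewrite /= szN; nat_lia.
  have ukc : uniq (k :: c) by rewrite (perm_uniq pc).
  have cD : {subset c <= D}.
    by move=> x xc; rewrite -pD -(perm_mem pc) inE xc orbT.
  have lastc : last k c = f N.
    rewrite -lastf -[in RHS](cat_take_drop i.+1 p) !last_cat_nonempty //.
    by case: (drop _ _) d0.
  have noham' c' : cycle e c' -> ~~ perm_eq c' (k :: c).
    by move=> cyc'; apply/negP => pc'; apply: (noham c') => //; apply: perm_trans pc.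
  have stable := stable_successors cyc noham'.
  exists (k |: [set nth k c j.+1 | j : 'I_(size c).-1 & e k (nth k c j)]).
    apply/subsetP => x /setU1P[->//|/imsetP[j _ ->]].
    by apply/cD/mem_nth; rewrite -ltn_predRL.
  split=> //; rewrite cardsU1 card_in_imset; last first.
    move=> j1 j2 _ _ /eqP; rewrite nth_uniq ?eqSS; first by move/eqP/val_inj.
    - by rewrite -ltn_predRL.
    - by rewrite -ltn_predRL.
    - by case/andP: ukc.
  have -> : k \notin [set nth k c j.+1 | j : 'I_(size c).-1 & e k (nth k c j)].
    case/andP: ukc => kc _; apply: contra kc => /imsetP[j _ ->].
    by rewrite mem_nth // -ltn_predRL.
  (* [k] is not adjacent to the last vertex of [c], so no neighbour is lost by leaving out the last
     index, and the stable set has [degree_in D k] + 1 elements. *)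
  have deg_eq : degree_in D k = #|[set j : 'I_(size c).-1 | e k (nth k c j)]|.
    have -> : degree_in D k = degree_in (D :\ k) k.
      by apply: eq_card => y; rewrite !inE; case: eqP => //= ->; rewrite e_irr andbF.
    rewrite (@degree_in_nth _ k k c); first last.
    - by move=> y; rewrite !inE -pD -(perm_mem pc) inE => /andP[/negPf->].
    - by move=> x xc; rewrite !inE cD // andbT; case/andP: ukc => kc _; apply: contraNneq kc => <-.
    - by case/andP: ukc.
    have -> : size c = (size c).-1.+1 by rewrite szc; nat_lia.
    rewrite big_ord_recr /= nth_last lastc (negPf ekN) addn0 -sum1_card big_mkcond [RHS]big_mkcond.
    by apply: eq_bigr => j _; rewrite inE; case: (e _ _).
  by rewrite -deg_eq; move: degk; rewrite ?szN; nat_lia.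
rewrite negb_exists => /forallP mono.
have ex_nadj : exists j, (0 < j) && ~~ e (f 0) (f j) by exists N; rewrite nadj0N; nat_lia.
pose j := ex_minn ex_nadj; have [j0 nadjj jmin] : [/\ 0 < j, ~~ e (f 0) (f j)
    & forall i, (0 < i) && ~~ e (f 0) (f i) -> j <= i].
  by rewrite /j; case: ex_minnP => m /andP[].
have jN : j <= N by apply: jmin; rewrite nadj0N; nat_lia.
have adj_lt i : 0 < i -> i < j -> e (f 0) (f i).
  by move=> i0; apply: contraTT => nadj; rewrite -leqNgt jmin // i0.
have nadj_ge i : j <= i -> i <= N -> ~~ e (f 0) (f i).
  elim: i => [|i IH]; first by nat_lia.
  rewrite leq_eqVlt => /predU1P[<- //|lt_ji lt_iN].
  have := mono (Ordinal lt_iN); rewrite /= IH //; last by nat_lia.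
  by rewrite (_ : 0 < i) //; nat_lia.
have j1 : 1 < j by rewrite ltn_neqAle j0 andbT; apply: contraNneq nadjj => <-.
(* [f m] is the last neighbour of [f 0] and, by [exact], the first neighbour of [f N]. An edge from
   before [f m] to after it gives a double crossing. *)
pose m := j.-1; pose A := [set x in take m p]; pose B := [set x in drop m.+1 p].
have p_eq : p = take m p ++ f m :: drop m.+1 p.
  by rewrite -drop_nth ?cat_take_drop //; rewrite ?szN /m; nat_lia.
have := up; rewrite {1}p_eq cat_uniq /= negb_or => /and4P[ut /andP[mt td] md ud].
apply: Or32; exists (f m), A, B; split.
- by apply: fD; rewrite ?szN /m; nat_lia.
- apply/set0Pn; exists (f 0); rewrite inE -[f 0](@nth_take m) ?mem_nth ?size_takel;
    rewrite ?szN /m; nat_lia.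
- apply/set0Pn; exists (f N); rewrite inE; apply/(nthP x0).
  exists (N - m.+1); rewrite ?size_drop ?nth_drop; rewrite ?szN /m; first by nat_lia.
  by congr nth; nat_lia.
- apply/setP => x; rewrite !inE -pD {1}p_eq mem_cat inE.
  by case: eqP => [->|_] /=; first by rewrite (negPf mt) (negPf md).
split.
  rewrite disjoint_sym; apply/pred0P => x /=; rewrite !inE; apply/negP => /andP[xd xt].
  by case/negP: td; apply/hasP; exists x.
move=> a b; rewrite !inE => /(nthP x0)[i + <-] /(nthP x0)[l + <-].
rewrite size_takel ?size_drop ?nth_drop; last by rewrite ?szN /m; nat_lia.
move=> lt_im; rewrite szN => lt_l; rewrite nth_take //; apply/negP => adj.
have [|||||c] := @double_crossing_cycle x0 p i (m + l) sp; rewrite -?addSn //.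
- by nat_lia.
- by rewrite szN; nat_lia.
- by apply: adj_lt => //; rewrite /m in lt_im; nat_lia.
- rewrite lastf exact; last by rewrite ?szN; nat_lia.
  by apply: nadj_ge; rewrite /m in lt_l *; nat_lia.
exact: noham.
Qed.

End Dichotomy.

(** * H-force sets *)

Section CycleLemmas.

Variables (T : finType) (e : rel T).
Hypotheses (e_sym : symmetric e) (e_irr : irreflexive e).

(* The successor map of c sends S injectively into the complement of S. *)
Lemma stable_cycle (S : {set T}) (c : seq T) :
    cycle e c -> uniq c -> {subset S <= c} -> stable_set e S ->
    #|T| <= 2 * #|S| ->
  forall v, v \in c.
Proof.
move=> cyc uc Sc stS leS v.
have card_im : #|next c @: S| = #|S|.
  by rewrite card_imset //; apply: can_inj (prev_next uc).
have sub : S :|: next c @: S \subset [set x in c].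
  apply/subsetP => x /setUP[/Sc|/imsetP[y /Sc yc ->]]; rewrite inE //.
  by rewrite mem_next.
have dis : S :&: next c @: S = set0.
  apply/setP => x; rewrite !inE; apply/negP => /andP[xS /imsetP[y yS x_eq]].
  by have := stS y x yS xS; rewrite x_eq next_cycle // Sc.
have := subset_leq_card sub; rewrite cardsU dis cards0 card_im subn0 => le_c.
have /eqP c_all : [set x in c] == setT.
  by rewrite eqEcard subsetT cardsT (leq_trans leS) // mul2n -addnn.
by have := in_setT v; rewrite -c_all inE.
Qed.

Lemma path_in_part (X A B : {set T}) (a : T) (p : seq T) :
    ~: X = A :|: B -> {in A & B, forall a b, ~~ e a b} ->
    a \in A -> path e a p -> {in p, forall x, x \notin X} -> last a p \in A.
Proof.
move=> XC noAB; elim: p a => //= b p IH a aA /andP[ab pb] pX.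
apply: IH => //; last by move=> x xp; apply: pX; rewrite inE xp orbT.
have : b \in ~: X by rewrite inE pX // mem_head.
by rewrite XC inE => /orP[//|bB]; have := noAB a b aA bB; rewrite ab.
Qed.

(** Each of the two arcs of the cycle between [a] and [b] has to cross [X]. The arcs are disjoint,
    so they use up both vertices of [X]. *)
Lemma cycle_meets_separator (X A B : {set T}) (c : seq T) (a b : T) :
    #|X| = 2 -> ~: X = A :|: B -> [disjoint A & B] ->
    {in A & B, forall a b, ~~ e a b} ->
    cycle e c -> uniq c -> a \in A -> b \in B -> a \in c -> b \in c ->
  {subset X <= c}.
Proof.
move=> X2 XC disAB noAB cyc uc aA bB ac bc.
have noBA : {in B & A, forall b a, ~~ e b a}.
  by move=> x y xB yA; rewrite e_sym; apply: noAB.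
have aDb : b != a by apply: contraTneq aA => <-; rewrite (disjointFl disAB).
have [i s rot_c] := rot_to ac.
have sc x : (x \in c) = (x \in a :: s) by rewrite -rot_c mem_rot.
have: cycle e (rot i c) by rewrite rot_cycle.
have: uniq (rot i c) by rewrite rot_uniq.
rewrite rot_c; move: (bc); rewrite sc inE (negPf aDb) /= => bs.
case/splitPr: bs sc => s1 s2 sc.
rewrite /= cat_uniq rcons_path cat_path last_cat /= negb_or => /and5P[_ _ /andP[_ s12] _ _].
case/andP=> /andP[p1 /andP[e1 p2]] e2.
have [x1 x1s x1X] : exists2 x, x \in s1 & x \in X.
  apply/hasP; apply: contraT => /hasPn nx.
  have := path_in_part XC noAB aA p1 nx => lA.
  by have := noAB _ _ lA bB; rewrite e1.
have [x2 x2s x2X] : exists2 x, x \in s2 & x \in X.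
  apply/hasP; apply: contraT => /hasPn nx.
  have XC' : ~: X = B :|: A by rewrite setUC.
  have := path_in_part XC' noBA bB p2 nx => lB.
  by have := noBA _ _ lB aA; rewrite e2.
have x12 : x1 != x2.
  by apply: contraNneq s12 => x_eq; apply/hasP; exists x2; rewrite // -x_eq.
have /eqP X_eq : [set x1; x2] == X.
  rewrite eqEcard cards2 x12 X2 andbT; apply/subsetP => x.
  by rewrite !inE => /orP[]/eqP->.
move=> x; rewrite -X_eq !inE sc inE mem_cat inE => /orP[]/eqP->.
  by rewrite x1s orbT.
by rewrite x2s !orbT.
Qed.

Lemma cycle_two_neighbors (c : seq T) (a : T) : graph_cycle e c -> a \in c ->
  exists b d, [/\ b != d, e a b, e a d, b \in c & d \in c].
Proof.
case/and3P=> szc cyc uc ac; have [i s rot_c] := rot_to ac.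
have sc x : (x \in c) = (x \in a :: s) by rewrite -rot_c mem_rot.
have: cycle e (rot i c) by rewrite rot_cycle.
have: uniq (rot i c) by rewrite rot_uniq.
have: 2 < size (rot i c) by rewrite size_rot.
rewrite rot_c; case: s sc {rot_c} => // b s; case/lastP: s => // s d sc _.
rewrite /= rcons_path last_rcons mem_rcons inE negb_or.
case/and3P=> _ /andP[bd _] _ /and3P[ab _ da].
exists b, d; split; rewrite ?bd ?ab ?sc ?inE ?mem_rcons ?inE ?eqxx ?orbT //.
by rewrite e_sym.
Qed.

End CycleLemmas.

(** * Rigidity of the exceptional graphs and their H-force sets *)

Section OreType.

Variables (T : finType) (e : rel T).
Hypotheses (e_sym : symmetric e) (e_irr : irreflexive e).
Hypotheses (ore : OTG e) (n3 : 3 <= #|T|).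

(** Source of the lower bounds: when the cycle misses [v] alone, the vertex found is [v]. *)
Lemma Hforce_set_subset (X : {set T}) (c : seq T) (v : T) :
  Hforce_set e X -> graph_cycle e c -> v \notin c -> exists2 x, x \in X & x \notin c.
Proof.
case=> _ forceX cyc vc; apply/subsetPn; apply/negP => /subsetP Xc.
by have [|_ /(_ v)] := forceX c; [split | rewrite (negPf vc)].
Qed.

Lemma minimum_Hforce_setP (X : {set T}) :
    Hforce_set e X -> (forall Y, Hforce_set e Y -> #|X| <= #|Y|) ->
  minimum_Hforce_set e X.
Proof. by move=> forceX minX; split=> //; split=> //; exists X. Qed.

Definition balanced_stable (S : {set T}) : Prop :=
  stable_set e S /\ #|T| <= 2 * #|S|.

Record separation (X A B : {set T}) : Prop := Separation {
  sep_card : #|X| = 2;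
  sep_cover : ~: X = A :|: B;
  sep_disjoint : [disjoint A & B];
  sep_left : A != set0;
  sep_right : B != set0;
  sep_edges : {in A & B, forall a b, ~~ e a b}
}.

Lemma separation_sym X A B : separation X A B -> separation X B A.
Proof.
case=> *; split=> //; first by rewrite setUC.
  by rewrite disjoint_sym.
by move=> b a *; rewrite e_sym; auto.
Qed.

Lemma balanced_card (S : {set T}) : balanced_stable S -> 1 < #|S|.
Proof. by case=> _; move: n3; lia. Qed.

(** Two vertices of [S] have at most |T| - |S| <= |T| / 2 neighbours each and degree sum at least
    |T|, so both are adjacent to the whole complement. *)
Lemma balanced_degree (S : {set T}) (s : T) : balanced_stable S -> s \in S ->
  [set v | e s v] = ~: S.
Proof.
move=> balS sS; have [stS leS] := balS.
have sub x : x \in S -> [set v | e x v] \subset ~: S.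
  move=> xS; apply/subsetP => y; rewrite !inE.
  by apply: contraTN => yS; apply: stS.
have /card_gt0P[x] : 0 < #|S :\ s|.
  by have := balanced_card balS; rewrite (cardsD1 s) sS.
rewrite !inE => /andP[xs xS].
have := ore xs (stS _ _ xS sS).
have := subset_leq_card (sub x xS); have := subset_leq_card (sub s sS).
move=> le1 le2 le3; apply/eqP; rewrite eqEcard sub //=.
by move: leS le1 le2 le3; rewrite /degree -(cardsC S); lia.
Qed.

Lemma balanced_adj (S : {set T}) (s x : T) : balanced_stable S -> s \in S ->
  e s x = (x \notin S).
Proof. by move=> balS sS; have /setP/(_ x) := balanced_degree balS sS; rewrite !inE. Qed.

Lemma balanced_half (S : {set T}) : balanced_stable S -> #|~: S| = #|S|.
Proof.
move=> balS; have [stS leS] := balS.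
have [s [t [sS tS st]]] : exists s t, [/\ s \in S, t \in S & s != t].
  by apply/card_gt1P/balanced_card.
have := ore st (stS _ _ sS tS).
rewrite /degree !(balanced_degree balS) //.
by move: leS; rewrite -(cardsC S); lia.
Qed.

(** For [b] in [B], the vertices [a] and [b] have at most |A| + 1 and |B| + 1 neighbours, and |T| =
    |A| + |B| + 2: equality in Ore's condition forces every adjacency that the cut permits. *)
Lemma separation_adj X A B a y : separation X A B -> a \in A ->
  e a y = (y != a) && (y \notin B).
Proof.
case=> X2 XC disAB A0 /set0Pn[b bB] noAB aA.
have aB : a \notin B by rewrite (disjointFr disAB).
have bA : b \notin A by rewrite (disjointFl disAB).
have ab : a != b by apply: contraTneq bB => <-.
have sub1 : [set v | e a v] \subset ~: (a |: B).
  apply/subsetP => z; rewrite !inE negb_or => az; apply/andP; split.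
    by apply: contraTneq az => ->; rewrite e_irr.
  by apply: contraTN az => zB; apply: noAB.
have sub2 : [set v | e b v] \subset ~: (b |: A).
  apply/subsetP => z; rewrite !inE negb_or => bz; apply/andP; split.
    by apply: contraTneq bz => ->; rewrite e_irr.
  by apply: contraTN bz => zA; rewrite e_sym; apply: noAB.
have cardAB : #|A| + #|B| + 2 = #|T|.
  rewrite -X2 -(cardsC X) XC cardsU disjoint_setI0 // cards0 subn0; lia.
have := ore ab (noAB _ _ aA bB).
have := subset_leq_card sub1; have := subset_leq_card sub2.
rewrite /degree => le2 le1 le3.
have := cardsC (a |: B); have := cardsC (b |: A).
rewrite !cardsU1 aB bA => c2 c1.
have /eqP/setP/(_ y) : [set v | e a v] == ~: (a |: B).
  rewrite eqEcard sub1 /=; lia.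
by rewrite !inE negb_or.
Qed.

(** The graph is C_4, whose H-force number is 1 instead of |T| - 2; the lower bounds below rule it
    out by a vertex of degree at least 3. *)
Lemma separation_small_degree X A B :
  separation X A B -> stable_set e X -> #|T| <= 4 -> forall y, degree e y <= 2.
Proof.
move=> sepX stX n4 y; have sepX' := separation_sym sepX.
have [X2 XC disAB A0 B0 noAB] := sepX.
have C2 : #|~: X| <= 2 by have := cardsC X; lia.
have deg_part P Q : separation X P Q -> y \in P -> degree e y <= 2.
  move=> sepPQ yP; have [_ _ dis _ /set0Pn[b bQ] _] := sepPQ.
  have yb : y != b by apply: contraTneq bQ => <-; rewrite (disjointFr dis).
  have : [set v | e y v] \subset ~: [set y; b].
    apply/subsetP => z; rewrite !inE (separation_adj _ sepPQ yP) negb_or.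
    by case/andP=> -> zQ /=; apply: contraNneq zQ => ->.
  move/subset_leq_card; have := cardsC [set y; b]; rewrite cards2 yb /degree; lia.
have [yX|yX] := boolP (y \in X).
  apply: leq_trans C2; apply: subset_leq_card; apply/subsetP => z; rewrite !inE.
  by apply: contraTN => zX; apply: stX.
have : y \in ~: X by rewrite inE.
by rewrite XC inE => /orP[yA|yB]; [apply: deg_part sepX yA | apply: deg_part sepX' yB].
Qed.

Lemma separation_Hforce X A B : separation X A B -> Hforce_set e (~: X).
Proof.
case=> X2 XC disAB /set0Pn[a aA] /set0Pn[b bB] noAB; split.
  by apply/set0Pn; exists a; rewrite XC inE aA.
move=> c [cyc Xc]; split=> // v; have /and3P[_ cc uc] := cyc.
have [vX|vX] := boolP (v \in X); last by apply: Xc; rewrite inE.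
by apply: (cycle_meets_separator e_sym X2 XC disAB noAB cc uc aA bB) vX;
  apply: Xc; rewrite XC inE ?aA ?bB ?orbT.
Qed.

Lemma balanced_Hforce S : balanced_stable S -> Hforce_set e S.
Proof.
move=> balS; have [stS leS] := balS; split.
  by rewrite -card_gt0 ltnW // balanced_card.
move=> c [cyc Sc]; split=> //; have /and3P[_ cc uc] := cyc.
exact: stable_cycle cc uc Sc stS leS.
Qed.

(** A vertex [d] off the cycle has no neighbour on it, since the vertices of the cycle already have
    two there. Then [d] has at most |T| - 4 neighbours, too few for Ore's condition with [v]. *)
Lemma two_regular_Hforce (v : T) :
  (forall u, degree e u <= 2) -> Hforce_set e [set v].
Proof.
move=> deg2; split; first by apply/set0Pn; exists v; rewrite set11.
move=> c [cyc /(_ v (set11 v)) vc]; split=> // d; apply: contraT => dc.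
have nd a : a \in c -> ~~ e d a.
  move=> ac; have [b [b' [bb' ab ab' bc b'c]]] := cycle_two_neighbors e_sym cyc ac.
  apply: contraTN (deg2 a) => da; rewrite -ltnNge.
  have <- : #|[set d; b; b']| = 3.
    have db : d != b by apply: contraNneq dc => ->.
    have db' : d != b' by apply: contraNneq dc => ->.
    by rewrite -setUA cardsU1 cards2 bb' !inE negb_or db db'.
  apply: subset_leq_card; apply/subsetP => z; rewrite !inE.
  by rewrite -orbA => /or3P[]/eqP->; rewrite // e_sym.
have dv : d != v by apply: contraNneq dc => ->.
have /and3P[szc _ uc] := cyc.
have := ore dv (nd v vc); have := deg2 v.
have : degree e d <= #|~: [set x in d :: c]|.
  apply: subset_leq_card; apply/subsetP => z; rewrite !inE negb_or => dz.
  apply/andP; split; last by apply: contraTN dz; apply: nd.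
  by apply: contraTneq dz => ->; rewrite e_irr.
have := cardsC [set x in d :: c]; rewrite cardsE (card_uniqP _) /= ?dc //; nat_lia.
Qed.

(** Deleting [v] lowers each degree and the number of vertices by at most one, so Ore's condition
    survives up to one. A cut vertex of the rest forms a cut together with [v]. *)
Lemma missing_vertex (v : T) : 3 < #|T| ->
  [\/ exists2 c, graph_cycle e c & c =i ~: [set v],
      exists x A B, v != x /\ separation [set v; x] A B
    | exists2 S, balanced_stable S & v \notin S].
Proof.
move=> n4; have cardD : #|~: [set v]|.+1 = #|T|.
  by have := cardsC [set v]; rewrite cards1.
have degD x : degree e x <= (degree_in e (~: [set v]) x).+1.
  rewrite /degree (cardsD1 v) -add1n leq_add ?leq_b1 //.
  by apply: subset_leq_card; apply/subsetP => y; rewrite !inE.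
have [|x y _ _ xy nxy|[c cyc cD]|[x [A [B]]]|[S SD [stS leS]]] :=
    @hamiltonian_dichotomy _ e e_sym e_irr (~: [set v]).
- by rewrite -ltnS cardD.
- by have := ore xy nxy; have := degD x; have := degD y; lia.
- by apply: Or31; exists c.
- case=> xD A0 B0 D_eq [disAB noAB]; apply: Or32; exists x, A, B.
  have vx : v != x by move: xD; rewrite !inE eq_sym.
  split=> //; split=> //; first by rewrite cards2 vx.
  by rewrite -D_eq setCU setDE setIC.
apply: Or33; exists S; first by split=> //; rewrite -cardD; lia.
by apply/negP => /(subsetP SD); rewrite !inE eqxx.
Qed.

(** Otherwise [a] lies in a second cut or off a balanced stable set. Vertices of [X] are adjacent to
    everything outside [X], so both sides of a second cut lie in [X]; a balanced stable set without
    [a] is [X] itself. Both times the graph is C_4. *)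
Lemma separation_missing X A B (a : T) :
    3 < #|T| -> (exists u, 2 < degree e u) -> separation X A B -> a \in A ->
  exists2 c, graph_cycle e c & c =i ~: [set a].
Proof.
move=> n4 [u deg_u] sepX aA; have sepX' := separation_sym sepX.
have [X2 XC disAB A0 /set0Pn[b bB] noAB] := sepX.
have not_small : stable_set e X -> #|T| <= 4 -> False.
  by move=> stX le4; have := separation_small_degree sepX stX le4 u; rewrite leqNgt deg_u.
have partC y : y \in X -> (y \notin A) && (y \notin B).
  by move=> yX; have : y \notin ~: X; [rewrite inE yX | rewrite XC !inE negb_or].
have aX : a \notin X by apply: contraL aA => /partC/andP[].
have adjX v w : v \in X -> w \notin X -> e v w.
  move=> vX wX; have /andP[vA vB] := partC v vX.
  have : w \in ~: X by rewrite inE.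
  rewrite e_sym XC inE => /orP[wA|wB].
    by rewrite (separation_adj v sepX wA) vB andbT; apply: contraNneq vA => ->.
  by rewrite (separation_adj v sepX' wB) vA andbT; apply: contraNneq vB => ->.
have [//|[x [P [Q [ax sepP]]]]|[S balS aS]] := missing_vertex a n4; exfalso.
  have [v] : exists v, v \in X :\ x.
    apply/set0Pn; rewrite -card_gt0; move: X2; rewrite (cardsD1 x).
    by case: (x \in X); [rewrite add1n => -[->] | rewrite add0n => ->].
  rewrite !inE => /andP[vx vX].
  have va : v != a by apply: contraNneq aX => <-.
  wlog vP : P Q sepP / v \in P.
    move=> gen; have : v \in ~: [set a; x] by rewrite !inE negb_or va.
    rewrite (sep_cover sepP) inE => /orP[].
      by apply: (gen P Q).
    by apply: (gen Q P (separation_sym sepP)).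
  have [_ PC disPQ P0 /set0Pn[w wQ] noPQ] := sepP.
  have vw : v != w by apply: contraTneq wQ => <-; rewrite (disjointFr disPQ).
  have QX z : z \in Q -> z \in X by move=> zQ; have := noPQ v z vP zQ; apply: contraNT; apply: adjX.
  have X_eq : X = [set v; w].
    by apply/esym/eqP; rewrite eqEcard cards2 vw X2 andbT subUset !sub1set vX QX.
  have PX z : z \in P -> z \in X.
    move=> zP; have := noPQ z w zP wQ; apply: contraNT => zX.
    by rewrite e_sym adjX // QX.
  apply: not_small.
    have nvw := noPQ v w vP wQ.
    by move=> y z; rewrite X_eq !inE => /orP[]/eqP-> /orP[]/eqP->; rewrite ?e_irr // e_sym.
  have : #|~: [set a; x]| <= #|X|.
    apply: subset_leq_card; rewrite PC; apply/subsetP => z; rewrite inE.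
    by case/orP; [apply: PX | apply: QX].
  by have := cardsC [set a; x]; rewrite cards2 ax X2; nat_lia.
have [s sS] : exists s, s \in S by apply/set0Pn; rewrite -card_gt0 ltnW // balanced_card.
have SA y : y \in S -> y \notin B.
  move=> yS; apply: contraL aS => yB.
  by have := balanced_adj a balS yS; rewrite e_sym (negPf (noAB a y aA yB)) => /esym/negbFE ->.
have SB y : y \in S -> y \notin A.
  move=> yS; have bS : b \notin S by apply: contraL bB => /SA.
  apply/negP => yA; have := balanced_adj b balS yS.
  by rewrite (negPf (noAB y b yA bB)) bS.
have SX : S \subset X.
  apply/subsetP => y yS; rewrite -[X]setCK XC !inE negb_or SA // SB //.
have S_eq : S = X by apply/eqP; rewrite eqEcard SX X2 balanced_card.
apply: not_small; first by rewrite -S_eq; case: balS.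
by case: balS => _; rewrite S_eq X2.
Qed.

(** A smaller [X] misses some [s] in [S] and some [h] outside [S]. If no cycle misses exactly [s],
    the graph is K_{m,m} with m at least 3, and K_{m-1,m-1} has a Hamiltonian cycle, which avoids
    [s] and [h]. *)
Lemma balanced_minimum (S X : {set T}) :
    3 < #|T| -> (exists u, 2 < degree e u) -> balanced_stable S ->
  Hforce_set e X -> #|S| <= #|X|.
Proof.
move=> n4 [u deg_u] balS forceX; rewrite leqNgt; apply/negP => ltXS.
have [stS leS] := balS; have halfS := balanced_half balS; have S2 := balanced_card balS.
have [s sS sX] : exists2 s, s \in S & s \notin X.
  by apply/subsetPn; apply: contraTN ltXS => /subset_leq_card; rewrite leqNgt.
have [h hS hX] : exists2 h, h \in ~: S & h \notin X.
  by apply/subsetPn; apply: contraTN ltXS => /subset_leq_card; rewrite halfS leqNgt.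
have {}hS : h \notin S by rewrite inE in hS.
have contra_cycle c v : graph_cycle e c -> v \notin c -> {subset X <= c} -> False.
  by move=> cyc vc Xc; have [x /Xc ->] := Hforce_set_subset forceX cyc vc.
have [[c cyc c_eq]|[x [P [Q [sx sepP]]]]|[R balR sR]] := missing_vertex s n4.
- apply: (contra_cycle c s cyc); first by rewrite c_eq !inE eqxx.
  by move=> x xX; rewrite c_eq !inE; apply: contraNneq sX => <-.
- have [PQC noPQ] := (sep_cover sepP, sep_edges sepP).
  (* A vertex of [S] on one side puts the other side, and then its own, into [S]; at most [x] would
     be left for the complement. *)
  have side P' Q' y : separation [set s; x] P' Q' -> y \in S -> y \in P' -> False.
    move=> sep' yS yP; have [_ C' dis' _ /set0Pn[q qQ] no'] := sep'.
    have qS z : z \in Q' -> z \in S.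
      by move=> zQ; have := no' y z yP zQ; rewrite (balanced_adj z balS yS) negbK.
    have pS z : z \in P' -> z \in S.
      move=> zP; have := no' z q zP qQ.
      by rewrite e_sym (balanced_adj z balS (qS q qQ)) negbK.
    suff : #|~: S| <= #|[set x]| by rewrite cards1 halfS leqNgt S2.
    apply: subset_leq_card; apply/subsetP => z; rewrite !inE => zS.
    apply: contraT => zx; have : z \in ~: [set s; x].
      by rewrite !inE negb_or zx andbT; apply: contraNneq zS => ->.
    by rewrite C' inE => /orP[/pS|/qS]; rewrite (negPf zS).
  have S_eq : S = [set s; x].
    apply/eqP; rewrite eqEcard cards2 sx S2 andbT; apply/subsetP => y yS.
    apply: contraT => yX; have : y \in ~: [set s; x] by rewrite inE.
    rewrite PQC inE => /orP[/(side P Q y sepP yS)|] //.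
    by move/(side Q P y (separation_sym sepP) yS).
  suff : degree e u <= 2 by rewrite leqNgt deg_u.
  apply: (separation_small_degree sepP); first by rewrite -S_eq.
  by move: leS; rewrite S_eq cards2 sx.
have [stR leR] := balR.
have RC : R = ~: S.
  apply/eqP; rewrite eqEcard; apply/andP; split.
    apply/subsetP => y yR; rewrite inE; apply/negP => yS.
    by have := balanced_adj s balR yR; rewrite sR; apply/negP/stS.
  by rewrite halfS; have := balanced_half balR; have := cardsC R; have := cardsC S;
    rewrite halfS => <- + eqR; rewrite eqR; lia.
have adjE x y : e x y = (x \in S) (+) (y \in S).
  have [xS|xS] := boolP (x \in S); first by rewrite (balanced_adj y balS xS).
  have xR : x \in R by rewrite RC inE.
  by rewrite (balanced_adj y balR xR) RC inE negbK.
have S3 : 2 < #|S|.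
  move: deg_u; rewrite /degree; have [uS|uS] := boolP (u \in S).
    by rewrite (balanced_degree balS uS) halfS.
  by rewrite (balanced_degree balR) RC ?inE // setCK.
have sh : s != h by apply: contraNneq hS => <-.
pose D := ~: [set s; h].
have sideD b : #|[set y in D | (y \in S) == b]| = #|S|.-1.
  case: b.
    have -> : [set y in D | (y \in S) == true] = S :\ s.
      apply/setP => y; rewrite !inE eqb_id negb_or -andbA.
      by have [->|_] := eqVneq y h; rewrite ?(negPf hS) ?andbF.
    by rewrite [in RHS](cardsD1 s) sS.
  have -> : [set y in D | (y \in S) == false] = ~: S :\ h.
    apply/setP => y; rewrite !inE eqbF_neg negb_or -andbA.
    by have [->|_] := eqVneq y s; rewrite ?sS ?andbF.
  by rewrite -halfS [in RHS](cardsD1 h) inE hS.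
have cardD : #|D| = 2 * #|S|.-1.
  have := cardsC [set s; h]; rewrite cards2 sh -/D.
  by have := cardsC S; rewrite halfS; nat_lia.
have degD x : degree_in e D x = #|S|.-1.
  rewrite -(sideD (x \notin S)); apply: eq_card => y; rewrite !inE adjE.
  by case: (x \in S); case: (y \in S).
(* Both exceptions fail, because nonadjacent vertices lie in one part and each part of [D] has m - 1
   >= 2 vertices. *)
have [|x y _ _ _ _|[c cyc c_eq]|[x [P [Q [xD P0 Q0 D_eq [dis noPQ]]]]]|[Q QD [stQ leQ]]] :=
    @hamiltonian_dichotomy _ e e_sym e_irr D.
- by rewrite cardD; nat_lia.
- by rewrite cardD !degD; nat_lia.
- apply: (contra_cycle c s cyc); first by rewrite c_eq !inE eqxx.
  move=> x xX; rewrite c_eq !inE negb_or; apply/andP; split.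
    by apply: contraNneq sX => <-.
  by apply: contraNneq hX => <-.
- have [[p pP] [q qQ]] := (set0Pn _ P0, set0Pn _ Q0).
  have same z z' : z \in P -> z' \in Q -> (z \in S) = (z' \in S).
    by move=> zP zQ; have := noPQ z z' zP zQ; rewrite adjE; case: (z \in S); case: (z' \in S).
  suff : #|[set y in D | (y \in S) == (p \notin S)]| <= #|[set x]|.
    by rewrite sideD cards1; nat_lia.
  apply: subset_leq_card; apply/subsetP => z; rewrite inE => /andP[zD /eqP zS].
  rewrite inE; apply: contraT => zx; have : z \in D :\ x by rewrite in_setD1 zx.
  rewrite D_eq inE => /orP[zP|zQ].
    by have := same z q zP qQ; rewrite -(same p q pP qQ) zS; case: (p \in S).
  by have := same p z pP zQ; rewrite zS; case: (p \in S).
have [/eqP|[q qQ]] := set_0Vmem Q.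
  by rewrite -cards_eq0 => /eqP Q0; move: leQ; rewrite Q0; nat_lia.
suff : #|Q| <= #|[set y in D | (y \in S) == (q \in S)]|.
  by rewrite sideD; move: leQ; rewrite cardD; nat_lia.
apply: subset_leq_card; apply/subsetP => y yQ; rewrite inE (subsetP QD) //=.
by have := stQ y q yQ qQ; rewrite adjE; case: (y \in S); case: (q \in S).
Qed.

(* When u is critical, its separator is a two-vertex cut of the graph or the
   complement of a stable set of n/2 vertices; otherwise it means nothing. *)
Definition separator (u : T) : {set T} :=
  [set w | e u w & 1 < #|[set b | ~~ e u b & e w b]|].

(** The second alternative says that the nonneighbours of [u], [u] included, form a balanced stable
    set. *)
Definition critical (u : T) : bool :=
  (#|separator u| == 2) ||
  (2 * degree e u <= #|T|) &&
    [forall w, forall b, ~~ e u w ==> ~~ e u b ==> ~~ e w b].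

(** The side opposite to [B] consists of [u] and the neighbours of [u] without a neighbour in
    [B]. *)
Lemma critical_separation (u : T) : #|separator u| = 2 ->
  exists A B, separation (separator u) A B.
Proof.
move=> X2; pose B := [set b | b != u & ~~ e u b].
exists (~: (separator u :|: B)), B.
have uX : u \notin separator u by rewrite inE e_irr.
have BX b : b \in B -> b \notin separator u.
  by rewrite !inE => /andP[_ /negPf->].
split=> //.
- apply/setP => y; rewrite !in_setU in_setC in_setC in_setU negb_or.
  by case: (boolP (y \in B)) => [/BX->|_]; rewrite ?orbT ?andbT ?orbF.
- by apply/pred0P => y /=; rewrite in_setC in_setU; case: (y \in B); rewrite ?orbT ?andbF.
- by apply/set0Pn; exists u; rewrite in_setC in_setU negb_or uX inE eqxx.
- have /set0Pn[w] : separator u != set0 by rewrite -card_gt0 X2.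
  (* [u] is itself among the vertices counted in [separator], so a count above 1 provides another
     one. *)
  rewrite inE => /andP[uw]; rewrite (cardsD1 u) !inE e_irr e_sym uw ltnS.
  by case/card_gt0P=> b; rewrite !inE => /and3P[bu ub _]; apply/set0Pn; exists b; rewrite inE bu.
move=> a b; rewrite in_setC in_setU negb_or => /andP[aX aB].
rewrite inE => /andP[bu ub].
move: aB; rewrite inE negb_and !negbK => /predU1P[-> //|ua].
move: aX; rewrite inE ua /= -leqNgt; apply: contraTN => ab; rewrite -ltnNge.
rewrite (cardsD1 u) !inE e_irr e_sym ua ltnS; apply/card_gt0P.
by exists b; rewrite !inE bu ub.
Qed.

(** By rigidity [u] is adjacent to [X] and the rest of [A]. The vertices of [X] are adjacent to all
    of [B], those of [A] to none of it. *)
Lemma separator_separation X A B u :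
  separation X A B -> u \in A -> separator u = X.
Proof.
move=> sepX uA; have sepX' := separation_sym sepX.
have [X2 XC disAB A0 /set0Pn[b bB] noAB] := sepX.
have uB : u \notin B by rewrite (disjointFr disAB).
have partC y : (y \in X) = (y \notin A) && (y \notin B).
  by rewrite -negb_or -in_setU -XC inE negbK.
apply/setP => w; rewrite inE partC (separation_adj w sepX uA).
have [wA|wA] /= := boolP (w \in A).
  apply/negbTE; rewrite negb_and -leqNgt; apply/orP; right.
  rewrite -[leqRHS](cards1 u); apply: subset_leq_card; apply/subsetP => y.
  rewrite !inE (separation_adj y sepX uA) negb_and !negbK andb_orl.
  case/orP=> [/andP[]//|/andP[yB]]; apply: contraTT => _; exact: noAB.
have -> : w != u by apply: contraNneq wA => ->.
have [//|wB] /= := boolP (w \in B).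
have uw : e u w by rewrite (separation_adj w sepX uA) wB andbT; apply: contraNneq wA => ->.
have wb : e w b by rewrite e_sym (separation_adj w sepX' bB) wA andbT; apply: contraNneq wB => ->.
rewrite (cardsD1 u) !inE e_irr e_sym uw ltnS; apply/card_gt0P.
exists b; rewrite !inE wb (noAB _ _ uA bB) !andbT.
by apply: contraNneq uB => <-.
Qed.

Lemma balanced_separator S s : balanced_stable S -> s \in S -> separator s = ~: S.
Proof.
move=> balS sS; apply/setP => w; rewrite !inE (balanced_adj w balS sS).
have [//|wS] /= := boolP (w \in S); rewrite (_ : [set b | _] = S) ?balanced_card //.
apply/setP => b; rewrite !inE (balanced_adj b balS sS) negbK.
by have [bS|//] := boolP (b \in S); rewrite e_sym (balanced_adj w balS bS) wS.
Qed.

Lemma balanced_critical S s : balanced_stable S -> s \in S -> critical s.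
Proof.
move=> balS sS; have [stS leS] := balS; apply/orP; right.
rewrite /degree (balanced_degree balS sS); apply/andP; split.
  by have := balanced_half balS; have := cardsC S; lia.
apply/forallP => w; apply/forallP => b.
by rewrite !(balanced_adj _ balS sS) !negbK; apply/implyP => wS; apply/implyP => bS; apply: stS.
Qed.

Lemma separation_critical X A B a : separation X A B -> a \in A -> critical a.
Proof.
move=> sepX aA; rewrite /critical (separator_separation sepX aA).
by rewrite (sep_card sepX).
Qed.

Lemma high_degree_card : (exists v, 2 < degree e v) -> 3 < #|T|.
Proof.
case=> v deg_v; apply: leq_ltn_trans deg_v _.
have := cardsC [set v]; rewrite cards1 add1n => <-; rewrite ltnS.
apply: subset_leq_card; apply/subsetP => y; rewrite !inE.
by apply: contraTneq => ->; rewrite e_irr.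
Qed.

Lemma critical_minimum (u : T) : (exists v, 2 < degree e v) -> critical u ->
  minimum_Hforce_set e (~: separator u).
Proof.
move=> exv; have n4 := high_degree_card exv.
case/orP=> [/eqP/critical_separation[A [B sepX]]|/andP[le_deg /forallP noE]].
  apply: minimum_Hforce_setP (separation_Hforce sepX) _ => Y forceY.
  apply: subset_leq_card; apply/subsetP => a; rewrite (sep_cover sepX) inE => aAB.
  have [c cyc c_eq] : exists2 c, graph_cycle e c & c =i ~: [set a].
    have sepX' := separation_sym sepX.
    by case/orP: aAB; [apply: separation_missing sepX | apply: separation_missing sepX'].
  have [|y yY] := Hforce_set_subset (v := a) forceY cyc.
    by rewrite c_eq !inE eqxx.
  by rewrite c_eq !inE negbK => /eqP <-.
have balS : balanced_stable (~: [set v | e u v]).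
  split=> [x y|]; last first.
    by have := cardsC [set v | e u v]; move: le_deg; rewrite /degree; lia.
  rewrite !inE => ux uy; have /forallP/(_ y) := noE x.
  by rewrite ux uy.
have uS : u \in ~: [set v | e u v] by rewrite !inE e_irr.
rewrite (balanced_separator balS uS) setCK.
apply: minimum_Hforce_setP (balanced_Hforce balS) _ => Y.
exact: balanced_minimum.
Qed.

Lemma no_critical_minimum : (exists v, 2 < degree e v) ->
  (forall u, ~~ critical u) -> minimum_Hforce_set e setT.
Proof.
move=> exv noc; have n4 := high_degree_card exv.
apply: minimum_Hforce_setP.
  split=> [|c [cyc Tc]]; last by split=> // v; apply: Tc.
  by rewrite -card_gt0 cardsT; lia.
move=> Y forceY; apply: subset_leq_card; apply/subsetP => a _.
have [[c cyc c_eq]|[x [P [Q [_ sepP]]]]|[S balS _]] := missing_vertex a n4.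
- have [|y yY] := Hforce_set_subset (v := a) forceY cyc.
    by rewrite c_eq !inE eqxx.
  by rewrite c_eq !inE negbK => /eqP <-.
- have /set0Pn[p pP] := sep_left sepP.
  by have := noc p; rewrite (separation_critical sepP pP).
have /card_gt0P[s sS] : 0 < #|S| by rewrite ltnW // balanced_card.
by have := noc s; rewrite (balanced_critical balS sS).
Qed.

Lemma two_regular_minimum (v : T) :
  (forall u, degree e u <= 2) -> minimum_Hforce_set e [set v].
Proof.
move=> deg2; apply: minimum_Hforce_setP (two_regular_Hforce v deg2) _ => Y [Y0 _].
by rewrite cards1 card_gt0.
Qed.

End OreType.

(** * Running programs *)

(* The registers are seen as a stack frame l; registers beyond its end hold
   arbitrary values. *)
Definition represents (s : state) (l : seq nat) (M : nat -> nat) : Prop :=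
  (forall r, r < size l -> regs s r = nth 0 l r) /\ cells s =1 M.

(** A Hoare triple for total correctness within [T] steps. *)
Definition run (W : nat) (p : cmd) (T : nat) (l : seq nat) (M : nat -> nat)
    (l' : seq nat) (M' : nat -> nat) : Prop :=
  forall s, represents s l M -> exists t s', [/\ exec W p s t s', t <= T & represents s' l' M'].

Section Run.

Variable W : nat.
Implicit Types (p q : cmd) (l : seq nat) (M : nat -> nat).

Lemma represents_set_reg s l M r v : r <= size l -> represents s l M ->
  represents (set_reg s r v) (set_nth 0 l r v) M.
Proof.
move=> le_r [sl sM]; split=> //= i; rewrite size_set_nth nth_set_nth /=.
by case: eqP => // ir lt_i; apply: sl; lia.
Qed.

Lemma run_skip l M : run W Skip 0 l M l M.
Proof. by move=> s sl; exists 0, s; split=> //; constructor. Qed.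

Lemma run_const r k l M : k < W -> r <= size l ->
  run W (Const r k) 1 l M (set_nth 0 l r k) M.
Proof.
move=> kW rl s sl; exists 1, (set_reg s r k); split=> //; first by constructor.
exact: represents_set_reg.
Qed.

Lemma run_op o r a b l M v : eval_op o (nth 0 l a) (nth 0 l b) = v ->
    v < W -> r <= size l -> a < size l -> b < size l ->
  run W (Op o r a b) 1 l M (set_nth 0 l r v) M.
Proof.
move=> <- vW rl al bl s sl; have [sl' _] := sl.
exists 1, (set_reg s r (eval_op o (regs s a) (regs s b))).
split; [constructor | | rewrite !sl'; first exact: represents_set_reg] => //.
by rewrite !sl'.
Qed.

Lemma run_read r a l M v : M (nth 0 l a) = v -> r <= size l -> a < size l ->
  run W (Read r a) 1 l M (set_nth 0 l r v) M.
Proof.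
move=> <- rl al s sl; have [sl' sM] := sl.
exists 1, (set_reg s r (cells s (regs s a))); split=> //; first by constructor.
by rewrite sl' // sM; apply: represents_set_reg.
Qed.

Lemma run_write a r l M : a < size l -> r < size l ->
  run W (Write a r) 1 l M l [eta M with nth 0 l a |-> nth 0 l r].
Proof.
move=> al rl s [sl sM]; exists 1, (set_mem s (regs s a) (regs s r)).
split=> //; first by constructor.
by split=> // k /=; rewrite !sl // sM.
Qed.

Lemma run_seq p q T U l1 M1 l2 M2 l3 M3 :
  run W p T l1 M1 l2 M2 -> run W q U l2 M2 l3 M3 ->
  run W (Seq p q) (T + U) l1 M1 l3 M3.
Proof.
move=> runp runq s1 /runp[t [s2 [ex1 le1 /runq[u [s3 [ex2 le2 sl3]]]]]].
by exists (t + u), s3; split=> //; [econstructor; eauto | apply: leq_add].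
Qed.

Lemma run_if r p q T l M l' M' : r < size l ->
    (nth 0 l r != 0 -> run W p T l M l' M') ->
    (nth 0 l r = 0 -> run W q T l M l' M') ->
  run W (If r p q) T.+1 l M l' M'.
Proof.
move=> rl runp runq s sl; have [sl' _] := sl.
have [r0|r0] := eqVneq (nth 0 l r) 0.
  have [t [s' [ex_s le_t sl1]]] := runq r0 s sl.
  by exists t.+1, s'; split=> //; apply: ExecIfFalse; rewrite // sl'.
have [t [s' [ex_s le_t sl1]]] := runp r0 s sl.
by exists t.+1, s'; split=> //; apply: ExecIfTrue; rewrite // sl'.
Qed.

(** Shortening the frame discards scratch registers. *)
Lemma run_weaken p T U l M l1 M1 l2 M2 :
    run W p T l M l1 M1 -> T <= U -> l2 = take (size l2) l1 -> M1 =1 M2 ->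
  run W p U l M l2 M2.
Proof.
move=> runp le_TU l2_eq M12 s /runp[t [s' [ex_s le_t [sl sM]]]].
exists t, s'; split=> //; first exact: leq_trans le_TU.
split=> [r lt_r|k]; last by rewrite sM M12.
have : size l2 <= size l1 by have := congr1 size l2_eq; rewrite size_take_min; lia.
by move=> le_l; rewrite sl ?(leq_trans lt_r) // l2_eq nth_take.
Qed.

(* r runs from n-1 down to 0, where n is in register 0; register 1 holds 1. *)
Definition for_ (r : nat) (p : cmd) : cmd :=
  Seq (Op Mul r 0 1) (While r (Seq (Op Defs.Sub r r 1) p)).

(** [L k] and [Ms k] describe the state when the counter holds [k]; as the loop descends, partial
    results are sums from [k] to [n]. Each round pays 2 for test and decrement, and 2 more go to the
    initialisation and the last test. *)
Lemma run_for r p T n l (L : nat -> seq nat) (Ms : nat -> nat -> nat) :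
    n < W -> 1 < r <= size l -> nth 0 l 0 = n -> nth 0 l 1 = 1 ->
    L n = set_nth 0 l r n ->
    (forall k, k <= n -> [/\ r < size (L k), nth 0 (L k) r = k & nth 0 (L k) 1 = 1]) ->
    (forall k, k < n -> run W p T (set_nth 0 (L k.+1) r k) (Ms k.+1) (L k) (Ms k)) ->
  run W (for_ r p) (n * T.+2 + 2) l (Ms n) (L 0) (Ms 0).
Proof.
move=> nW /andP[r1 rl] l0 l1 Ln LE runp.
rewrite addn2 -addn1 addnC; apply: run_seq.
  apply: run_op; [by rewrite l0 l1 /= muln1 | by [] | by [] | lia..].
rewrite -Ln; suff gen m : m <= n -> run W (While r (Seq (Op Defs.Sub r r 1) p))
    (m * T.+2).+1 (L m) (Ms m) (L 0) (Ms 0) by exact: gen.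
elim: m => [_|m IH lt_mn] s sl.
  have [rL r0 _] := LE 0 (leq0n _); have [sl' _] := sl.
  by exists 1, s; split=> //; apply: ExecWhileFalse; rewrite sl'.
have [rL rm one] := LE m.+1 lt_mn; have [sl' _] := sl.
have stepm : run W (Op Defs.Sub r r 1) 1 (L m.+1) (Ms m.+1) (set_nth 0 (L m.+1) r m) (Ms m.+1).
  by apply: run_op; rewrite ?rm ?one /= ?subn1 //; lia.
have [t [s' [ex_s le_t sl1]]] := run_seq stepm (runp m lt_mn) sl.
have [u [s2 [ex_s2 le_u sl2]]] := IH (ltnW lt_mn) s' sl1.
exists (t + u).+1, s2; split=> //; last by lia.
by apply: ExecWhileTrue ex_s ex_s2; rewrite sl' // rm.
Qed.

End Run.

(** * The algorithm *)

Section Program.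

Local Notation "p ;; q" := (Seq p q) (at level 90, right associativity).

(* r := M[a * n + b] for registers r, a, b *)
Definition entry (r a b : nat) : cmd := Op Mul r a 0 ;; Op Add r r b ;; Read r r.

(** Registers: 2 the choice, 3 the flag for a degree above 2, 4 the vertex [u], 5 its degree (in
    [write_cmd], the number of marked vertices), 6 the size of its separator, 7 the adjacencies
    among its nonneighbours, 8 the vertex [w], 9 the number of neighbours of [w] not adjacent to
    [u], from 10 on scratch. *)
Definition count_cmd : cmd :=
  Const 9 0 ;;
  for_ 10 (entry 11 4 10 ;; If 11 Skip (entry 11 8 10 ;; Op Add 9 9 11)).

Definition scan_cmd : cmd :=
  Const 5 0 ;; Const 6 0 ;; Const 7 0 ;;
  for_ 8 (count_cmd ;; entry 10 4 8 ;;
    If 10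
      (Op Add 5 5 1 ;; Op Defs.Sub 9 9 1 ;; If 9 (Op Add 6 6 1) Skip)
      (Op Add 7 7 9)).

(** Subtraction truncates: (t - 2) + (2 - t) vanishes only for t = 2, and 2d - n only for 2d <=
    n. *)
Definition test_cmd : cmd :=
  Const 8 2 ;; Op Defs.Sub 9 5 8 ;; If 9 (Const 3 1) Skip ;;
  Op Defs.Sub 9 6 8 ;; Op Defs.Sub 10 8 6 ;; Op Add 9 9 10 ;;
  If 9
    (Op Add 9 5 5 ;; Op Defs.Sub 9 9 0 ;; Op Add 9 9 7 ;; If 9 Skip (Op Mul 2 4 1))
    (Op Mul 2 4 1).

Definition select_cmd : cmd :=
  Const 1 1 ;; Op Add 2 0 0 ;; Const 3 0 ;; for_ 4 (scan_cmd ;; test_cmd).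

Definition mark_cmd : cmd :=
  Op Mul 9 0 0 ;; Op Add 9 9 8 ;; Write 9 1 ;; Op Add 5 5 1.

Definition write_cmd : cmd :=
  Op Mul 4 2 1 ;; Const 5 0 ;; Const 6 0 ;; Const 7 0 ;;
  for_ 8 (count_cmd ;; entry 10 4 8 ;;
    If 10 (Op Defs.Sub 9 9 1 ;; If 9 Skip mark_cmd) mark_cmd) ;;
  Op Mul 0 5 1.

(* Register 2 holds the last critical vertex found, or 2n if there is none: row
   2n of the memory is zero, so that its separator is empty. *)
Definition Hforce_cmd : cmd :=
  select_cmd ;;
  If 3 write_cmd (Op Mul 4 0 0 ;; Write 4 1 ;; Const 0 1).

Variables (W n : nat).
Hypotheses (n3 : 2 < n) (HW : 3 * n * n < W).

Section Memory.

Variable M : nat -> nat.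

(** The graph notions are restated on raw indices, so that they also make sense for row 2n, which
    belongs to no vertex. *)
Definition cnt (u w : nat) : nat :=
  \sum_(0 <= b < n) (if M (u * n + b) != 0 then 0 else M (w * n + b)).

Definition deg (u : nat) : nat := \sum_(0 <= w < n) (M (u * n + w) != 0).

Definition sep (u w : nat) : bool := (M (u * n + w) != 0) && (cnt u w - 1 != 0).

Definition sep_size (u : nat) : nat := \sum_(0 <= w < n) sep u w.

Definition bad (u : nat) : nat :=
  \sum_(0 <= w < n) (if M (u * n + w) != 0 then 0 else cnt u w).

Definition good (u : nat) : bool :=
  (sep_size u == 2) || (2 * deg u <= n) && (bad u == 0).

Hypothesis M1 : forall k, M k <= 1.

Lemma sum_nat_succ (F : nat -> nat) k :
  k < n -> \sum_(k <= w < n) F w = \sum_(k.+1 <= w < n) F w + F k.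
Proof. by move=> lt_k; rewrite big_ltn // addnC. Qed.

Lemma sum_nat_bound (F : nat -> nat) k c :
  (forall w, F w <= c) -> \sum_(k <= w < n) F w <= n * c.
Proof.
move=> Fc; apply: leq_trans (_ : (n - k) * c <= n * c); last by rewrite leq_mul2r leq_subr orbT.
by rewrite -sum_nat_const_nat leq_sum.
Qed.

Lemma run_entry r a b l u w :
    nth 0 l 0 = n -> nth 0 l a = u -> nth 0 l b = w ->
    u <= 2 * n -> w < n -> r <= size l -> a < size l -> b < size l -> 0 < r -> b < r ->
  run W (entry r a b) 3 l M (set_nth 0 l r (M (u * n + w))) M.
Proof.
move=> l0 la lb le_u lt_w rl al bl r0 br.
have l_pos : 0 < size l by lia.
(* Row 2n is the highest row read, whence the bound 3 n^2 on words. *)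
have lt1 : u * n + w < W by nia.
apply: (run_seq (T := 1) (U := 2)).
  by apply: run_op; rewrite /= ?la ?l0 //; apply: leq_ltn_trans lt1; apply: leq_addr.
apply: (run_seq (T := 1) (U := 1)).
  apply: run_op; first by rewrite !nth_set_nth /= eqxx (ltn_eqF br) lb.
  1: exact: lt1.
  1,2,3: by rewrite size_set_nth leq_max ?leqnn ?leqnSn ?bl ?orbT.
set l2 := set_nth 0 _ _ _.
rewrite (_ : set_nth 0 l r (M (u * n + w)) = set_nth 0 l2 r (M (u * n + w))).
  by apply: run_read; rewrite /l2 ?size_set_nth ?nth_set_nth /= ?eqxx // leq_max ?leqnn ?leqnSn.
by rewrite /l2 set_set_nth eqxx set_set_nth eqxx.
Qed.

Lemma cnt_le u w : cnt u w <= n.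
Proof.
by rewrite -[leqRHS]muln1; apply: sum_nat_bound => b; case: ifP.
Qed.

Lemma run_count g f u x y z w : u <= 2 * n -> w < n ->
  run W count_cmd (n * 10 + 3) [:: n; 1; g; f; u; x; y; z; w] M
    [:: n; 1; g; f; u; x; y; z; w; cnt u w] M.
Proof.
move=> le_u lt_w.
pose F b := if M (u * n + b) != 0 then 0 else M (w * n + b).
pose S k := \sum_(k <= b < n) F b.
have S_le k : S k <= n.
  by rewrite -[leqRHS]muln1; apply: sum_nat_bound => b; rewrite /F; case: ifP.
pose L k := [:: n; 1; g; f; u; x; y; z; w; S k; k].
have Sn : S n = 0 by rewrite /S big_geq.
apply: (@run_weaken _ _ (1 + (n * 10 + 2)) _ _ _ (L 0) M) => //; last by lia.
apply: run_seq; first by apply: run_const => //=; lia.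
apply: (@run_for W 10 _ 8 n _ L (fun=> M)) => //=; first by nia.
  by rewrite /L Sn.
move=> k lt_k /=.
have Sk : S k = F k + S k.+1 by rewrite /S big_ltn.
apply: (run_seq (T := 3) (U := 5)); first by apply: (@run_entry 11 4 10 _ u k).
rewrite /=; apply: (run_if (T := 4)) => //= Mu.
  apply: (run_weaken (T := 0)); [exact: run_skip | by [] | | by []].
  by rewrite /L Sk /F Mu.
apply: (run_weaken (T := 3 + 1)).
- apply: run_seq; first by apply: (@run_entry 11 8 10 _ w k); rewrite //=; lia.
  apply: (@run_op _ _ _ _ _ _ _ (S k)) => //=; first by rewrite Sk /F Mu addnC.
  by apply: leq_ltn_trans (S_le k) _; nia.
- by [].
- by [].
by [].
Qed.

Lemma run_scan g f u : u < n ->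
  run W scan_cmd (n * (n * 10 + 14) + 5) [:: n; 1; g; f; u] M
    [:: n; 1; g; f; u; deg u; sep_size u; bad u; 0] M.
Proof.
move=> lt_u.
pose D k := \sum_(k <= w < n) (M (u * n + w) != 0).
pose S k := \sum_(k <= w < n) sep u w.
pose B k := \sum_(k <= w < n) (if M (u * n + w) != 0 then 0 else cnt u w).
have D_le k : D k <= n * 1 by apply: sum_nat_bound => w; apply: leq_b1.
have S_le k : S k <= n * 1 by apply: sum_nat_bound => w; apply: leq_b1.
have B_le k : B k <= n * n.
  by apply: sum_nat_bound => w; case: ifP => // _; apply: cnt_le.
pose L k := [:: n; 1; g; f; u; D k; S k; B k; k].
have Dn : D n = 0 by rewrite /D big_geq.
have Sn : S n = 0 by rewrite /S big_geq.
have Bn : B n = 0 by rewrite /B big_geq.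
have W0 : 0 < W by lia.
apply: (@run_weaken _ _ (1 + (1 + (1 + (n * (n * 10 + 3 + (3 + 5)).+2 + 2)))) _ _ _
  (L 0) M) => //; last by lia.
apply: run_seq; first by apply: run_const.
apply: run_seq; first by apply: run_const.
apply: run_seq; first by apply: run_const.
apply: (@run_for W 8 _ _ n _ L (fun=> M)) => //=; first by nia.
  by rewrite /L Dn Sn Bn.
move=> k lt_k /=.
have Dk : D k = D k.+1 + (M (u * n + k) != 0) by apply: sum_nat_succ.
have Sk : S k = S k.+1 + sep u k by apply: (sum_nat_succ (fun w => sep u w : nat)).
have Bk : B k = B k.+1 + (if M (u * n + k) != 0 then 0 else cnt u k).
  by rewrite /B sum_nat_succ.
apply: run_seq; first by apply: run_count => //; lia.
apply: (run_seq (T := 3) (U := 5)); first by apply: (@run_entry 10 4 8 _ u k) => //=; lia.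
have c_le := cnt_le u k.
rewrite /=; apply: (run_if (T := 4)) => //= Mu; last first.
  apply: (run_weaken (T := 1)).
  - apply: (@run_op _ _ _ _ _ _ _ (B k)) => //=; first by rewrite Bk Mu.
    by apply: leq_ltn_trans (B_le k) _; nia.
  - by [].
  - by rewrite /L /= Dk Sk /sep Mu /= !addn0.
  by [].
rewrite Mu addn1 in Dk; rewrite Mu addn0 in Bk.
apply: (@run_weaken _ _ (1 + (1 + 2)) _ _ _ [:: n; 1; g; f; u; D k; S k; B k.+1; k] M) => //.
  apply: run_seq.
    apply: (@run_op _ _ _ _ _ _ _ (D k)) => //=; first by rewrite Dk addn1.
    by apply: leq_ltn_trans (D_le k) _; nia.
  apply: run_seq.
    by apply: (@run_op _ _ _ _ _ _ _ (cnt u k - 1)) => //=; nia.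
  rewrite /=; apply: (run_if (T := 1)) => //= c0.
    apply: run_weaken.
    - apply: (@run_op _ _ _ _ _ _ _ (S k)) => //=; first by rewrite Sk /sep Mu c0.
      by apply: leq_ltn_trans (S_le k) _; nia.
    - by [].
    - by [].
    by [].
  apply: (run_weaken (T := 0)); [exact: run_skip | by [] | | by []].
  by rewrite /= Sk /sep Mu c0 addn0.
by rewrite /L /= Bk.
Qed.

Lemma run_test g f u : u < n ->
  run W test_cmd 15 [:: n; 1; g; f; u; deg u; sep_size u; bad u; 0] M
    [:: n; 1; if good u then u else g; if 2 < deg u then 1 else f; u] M.
Proof.
move=> lt_u.
have D_le : deg u <= n * 1 by apply: sum_nat_bound => w; apply: leq_b1.
have S_le : sep_size u <= n * 1 by apply: sum_nat_bound => w; apply: leq_b1.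
have B_le : bad u <= n * n.
  by apply: sum_nat_bound => w; case: ifP => // _; apply: cnt_le.
have W1 : 2 < W by nia.
have nW : 3 * n < W by nia.
move: D_le S_le B_le; rewrite /good !muln1.
move: (deg u) (sep_size u) (bad u) => d t b D_le S_le B_le.
pose f' := if 2 < d then 1 else f.
pose g' := if (t == 2) || (2 * d <= n) && (b == 0) then u else g.
rewrite -/f' -/g'.
have uW : u < W by lia.
apply: (@run_weaken _ _ (1 + (1 + (2 + (1 + (1 + (1 + 6)))))) _ _ _ [:: n; 1; g'; f'; u] M) => //.
apply: run_seq; first by apply: run_const.
rewrite /=; apply: run_seq.
  by apply: (@run_op _ _ _ _ _ _ _ (d - 2)) => //=; lia.
apply: (@run_seq _ _ _ _ _ _ _ [:: n; 1; g; f'; u; d; t; b; 2; d - 2] M).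
  rewrite /=; apply: (run_if (T := 1)) => //= d2.
    by rewrite /f' (_ : 2 < d); [apply: (@run_const W 3 1) => //; lia | lia].
  rewrite /f' (_ : 2 < d = false); last by lia.
  by apply: (run_weaken (T := 0)); [exact: run_skip | | |].
apply: run_seq.
  by apply: (@run_op _ _ _ _ _ _ _ (t - 2)) => //=; lia.
apply: run_seq.
  by apply: (@run_op _ _ _ _ _ _ _ (2 - t)) => //=; lia.
apply: run_seq.
  by apply: (@run_op _ _ _ _ _ _ _ (t - 2 + (2 - t))) => //=; lia.
rewrite /=; apply: (run_if (T := 5)) => //= t2; last first.
  apply: (run_weaken (T := 1)) => //.
    by apply: (@run_op _ _ _ _ _ _ _ u) => //=; lia.
  by rewrite /= /g' (_ : t == 2) //; lia.
apply: (@run_weaken _ _ (1 + (1 + (1 + 2))) _ _ _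
  [:: n; 1; g'; f'; u; d; t; b; 2; d + d - n + b; 2 - t] M) => //.
apply: run_seq.
  by apply: (@run_op _ _ _ _ _ _ _ (d + d)) => //=; lia.
apply: run_seq.
  by apply: (@run_op _ _ _ _ _ _ _ (d + d - n)) => //=; lia.
apply: run_seq.
  by apply: (@run_op _ _ _ _ _ _ _ (d + d - n + b)) => //=; nia.
rewrite /=; apply: (run_if (T := 1)) => //= db.
  apply: (run_weaken (T := 0)); [exact: run_skip | by [] | | by []].
  by rewrite /= /g' (_ : _ || _ = false) //; lia.
apply: (run_weaken (T := 1)) => //.
  by apply: (@run_op _ _ _ _ _ _ _ u) => //=; lia.
by rewrite /= /g' (_ : _ || _) //; lia.
Qed.

(** Vertices are tried in descending order, so the smallest good one wins, as in a right fold. *)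
Definition choice_from (k : nat) : nat :=
  foldr (fun u g => if good u then u else g) (n + n) (iota k (n - k)).

Definition high_degree_from (k : nat) : bool :=
  has (fun u => 2 < deg u) (iota k (n - k)).

Lemma run_select :
  run W select_cmd (n * (n * (n * 10 + 14) + 22) + 5) [:: n] M
    [:: n; 1; choice_from 0; high_degree_from 0 : nat; 0] M.
Proof.
pose L k := [:: n; 1; choice_from k; high_degree_from k : nat; k].
have W1 : 1 < W by nia.
have nW : 3 * n < W by nia.
apply: (@run_weaken _ _ (1 + (1 + (1 + (n * (n * (n * 10 + 14) + 5 + 15).+2 + 2)))) _ _ _
  (L 0) M) => //; last by lia.
apply: run_seq; first by apply: run_const.
apply: run_seq.
  by apply: (@run_op _ _ _ _ _ _ _ (n + n)) => //=; lia.
apply: run_seq; first by apply: run_const => //; lia.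
apply: (@run_for W 4 _ _ n _ L (fun=> M)) => //=; first by lia.
  by rewrite /L /choice_from /high_degree_from subnn.
move=> k lt_k /=; apply: run_seq; first exact: run_scan.
apply: run_weaken; first exact: run_test.
- by [].
- rewrite /L /choice_from /high_degree_from -(subnSK lt_k) /=.
  by case: (2 < deg k).
by [].
Qed.

End Memory.

Section Output.

Variables (M : nat -> nat) (g : nat).
Hypotheses (M1 : forall k, M k <= 1) (M0 : forall k, n * n <= k -> M k = 0).
Hypothesis g_row : (g < n) || (g == n + n).

(** The memory once the output loop has dealt with the indices from [k] on. *)
Definition written (k a : nat) : nat :=
  if n * n + k <= a < n * n + n then (~~ sep M g (a - n * n) : nat) else M a.

(** The output cells overlap neither the matrix nor row 2n, so the separator can be recomputed while
    its complement is being written. *)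
Lemma written_row k u b : (u < n) || (u == n + n) -> b < n ->
  written k (u * n + b) = M (u * n + b).
Proof. by move=> u_row lt_b; rewrite /written ifN //; case/orP: u_row => [lt_u|/eqP->]; nia. Qed.

Lemma cnt_written k w : w < n -> cnt (written k) g w = cnt M g w.
Proof.
move=> lt_w; apply: eq_big_nat => b /andP[_ lt_b].
by rewrite !written_row ?lt_w.
Qed.

Definition unsep_size (k : nat) : nat := \sum_(k <= w < n) ~~ sep M g w.

Lemma run_write_cmd f x :
  run W write_cmd (n * (n * 10 + 15) + 7) [:: n; 1; g; f; x] M
    [:: unsep_size 0] (written 0).
Proof.
have W1 : 1 < W by nia.
have gW : g < W by case/orP: g_row => [|/eqP->]; nia.
have g2 : g <= 2 * n by case/orP: g_row => [|/eqP->]; lia.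
have H_le k : unsep_size k <= n * 1 by apply: sum_nat_bound => w; apply: leq_b1.
pose L k := [:: n; 1; g; f; g; unsep_size k; 0; 0; k].
have HW0 : n * n + n < W by nia.
apply: (@run_weaken _ _ (1 + (1 + (1 + (1 + ((n * (n * 10 + 3 + (3 + 7)).+2 + 2) + 1))))) _ _ _
  (set_nth 0 (L 0) 0 (unsep_size 0)) (written 0)) => //; last by lia.
apply: run_seq; first by apply: (@run_op _ _ _ _ _ _ _ g) => //=; lia.
apply: run_seq; first by apply: run_const => //; lia.
apply: run_seq; first by apply: run_const => //; lia.
apply: run_seq; first by apply: run_const => //; lia.
apply: run_seq; last first.
  by apply: (@run_op _ _ _ _ _ _ _ (unsep_size 0)) => //=; have := H_le 0; nia.
have written_n : written n =1 M.
  by move=> a; rewrite /written ifN //; lia.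
(* [written n] and [M] agree only pointwise, so the initial memory is exchanged before the loop rule
   applies. *)
suff loop : forall l, l = [:: n; 1; g; f; g; 0; 0; 0] -> run W
    (for_ 8 (count_cmd ;; entry 10 4 8 ;;
       If 10 (Op Defs.Sub 9 9 1 ;; If 9 Skip mark_cmd) mark_cmd))
    (n * (n * 10 + 3 + (3 + 7)).+2 + 2) l (written n) (L 0) (written 0).
  by move=> s [sl sM]; apply: loop => //; split=> // a; rewrite sM written_n.
move=> l ->; apply: (@run_for W 8 _ _ n _ L written) => //=; first by lia.
- by rewrite /L /unsep_size big_geq.
move=> k lt_k /=.
  have Wr1 a : written k.+1 a <= 1 by rewrite /written; case: ifP => // _; apply: leq_b1.
  have Hk : unsep_size k = unsep_size k.+1 + ~~ sep M g k.
    by apply: (sum_nat_succ (fun w => ~~ sep M g w : nat)).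
  apply: run_seq; first by apply: run_count.
  rewrite cnt_written //.
  apply: (run_seq (T := 3) (U := 7)); first by apply: (@run_entry _ 10 4 8 _ g k).
  rewrite written_row //.
  have mark T l' c y : 4 <= T -> l' = [:: n; 1; g; f; g; unsep_size k.+1; 0; 0; k; c; y] ->
      ~~ sep M g k -> run W mark_cmd T l' (written k.+1) (L k) (written k).
    move=> leT -> nsep.
    apply: (@run_weaken _ _ (1 + (1 + (1 + 1))) _ _ _
      [:: n; 1; g; f; g; unsep_size k; 0; 0; k; n * n + k; y]
      [eta written k.+1 with n * n + k |-> 1]) => //.
      apply: run_seq; first by apply: (@run_op _ _ _ _ _ _ _ (n * n)) => //=; lia.
      apply: run_seq; first by apply: (@run_op _ _ _ _ _ _ _ (n * n + k)) => //=; lia.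
      apply: run_seq; first by apply: run_write.
      apply: (@run_op _ _ _ _ _ _ _ (unsep_size k)) => //=; first by rewrite Hk nsep.
      by have := H_le k; nia.
    move=> a /=; rewrite /written; case: eqP => [->|a_ne].
      by rewrite ifT ?addKn ?nsep //; lia.
    by rewrite (_ : (n * n + k.+1 <= a < _) = (n * n + k <= a < n * n + n)) //; lia.
  rewrite /=; apply: (run_if (T := 6)) => //= Mg; last first.
    by apply: mark; rewrite ?/sep ?Mg.
  apply: (run_seq (T := 1) (U := 5)).
    by apply: (@run_op _ _ _ _ _ _ _ (cnt M g k - 1)) => //=; have := cnt_le M1 g k; lia.
  rewrite /=; apply: (run_if (T := 4)) => //= c0; last first.
    by apply: mark; rewrite ?/sep ?c0 ?andbF.
  have sepk : sep M g k by rewrite /sep Mg c0.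
  apply: (run_weaken (T := 0)); [exact: run_skip | by [] | by rewrite /L Hk sepk addn0 |].
  (* Nothing is written for a vertex of the separator: its cell is 0 from the start. *)
  move=> a; rewrite /written; have [->|a_ne] := eqVneq a (n * n + k).
    by rewrite ifN ?ifT ?addKn ?sepk ?M0 //; lia.
  by rewrite (_ : (n * n + k.+1 <= a < _) = (n * n + k <= a < n * n + n)) //; lia.
Qed.

End Output.

Definition choice (M : nat -> nat) : nat := choice_from M 0.

Lemma choice_row M : (choice M < n) || (choice M == n + n).
Proof.
rewrite /choice /choice_from; have : all (fun u => u < n) (iota 0 (n - 0)).
  by apply/allP => u; rewrite mem_iota; lia.
elim: (iota _ _) => [_|u r IH /= /andP[lt_u /IH]] /=; first by rewrite eqxx orbT.
by case: ifP; rewrite ?lt_u.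
Qed.

Lemma run_Hforce M : (forall k, M k <= 1) -> (forall k, n * n <= k -> M k = 0) ->
  if has (fun u => 2 < deg M u) (iota 0 n)
  then run W Hforce_cmd (100 * n ^ 3) [:: n] M
         [:: unsep_size M (choice M) 0] (written M (choice M) 0)
  else run W Hforce_cmd (100 * n ^ 3) [:: n] M [:: 1] [eta M with n * n |-> 1].
Proof.
move=> M1 M0; have W1 : 1 < W by nia.
have nW : n * n < W by nia.
have time : n * (n * (n * 10 + 14) + 22) + 5 + (n * (n * 10 + 15) + 7).+1 <= 100 * n ^ 3.
  by rewrite !expnS; nia.
have high := run_select M1.
rewrite -{1}[n]subn0 -/(high_degree_from M 0).
have runT p T l M' : run W p T [:: n] M l M' -> T <= 100 * n ^ 3 ->
    run W p (100 * n ^ 3) [:: n] M l M'.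
  by move=> runp le_T; apply: run_weaken runp le_T _ _; rewrite ?take_size.
case: ifP => flag; apply: runT time; apply: run_seq high _; rewrite flag /=.
  apply: run_if => //= _; apply: run_write_cmd => //; exact: choice_row.
apply: run_if => //= _.
apply: (@run_weaken _ _ (1 + (1 + 1)) _ _ _ [:: 1; 1; choice M; 0; n * n]) => //; last by lia.
apply: run_seq; first by apply: (@run_op _ _ _ _ _ _ _ (n * n)).
by apply: run_seq; [apply: run_write | apply: run_const].
Qed.

End Program.

(** * The program on the adjacency matrix of a graph *)

Section Final.

Variables (n : nat) (e : rel 'I_n).
Hypotheses (n3 : 3 <= n) (e_sym : symmetric e) (e_irr : irreflexive e) (ore : OTG e).

Let M := cells (input e).

Lemma input_le1 k : M k <= 1.
Proof. exact: leq_b1. Qed.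

Lemma input_out k : n * n <= k -> M k = 0.
Proof.
move=> le_k; rewrite /M /= (_ : [exists i, _] = false) //.
apply/negbTE; rewrite negb_exists; apply/forallP => i; rewrite negb_exists.
apply/forallP => j; rewrite negb_and; apply/orP; left.
by apply: contraTneq le_k => ->; have := ltn_ord i; have := ltn_ord j; nia.
Qed.

Lemma input_entry (i j : 'I_n) : M (i * n + j) = e i j.
Proof.
rewrite /M /=; congr nat_of_bool; apply/existsP/idP => [[i' /existsP[j' /andP[/eqP eq_ij]]]|eij].
  have n0 : 0 < n by lia.
  have j_eq : j = j'.
    apply: val_inj; have := congr1 (modn^~ n) eq_ij.
    by rewrite !modnMDl !modn_small.
  have i_eq : i = i'.
    apply: val_inj; have := congr1 (divn^~ n) eq_ij.
    by rewrite !divnMDl // !divn_small // !addn0.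
  by rewrite i_eq j_eq.
by exists i; apply/existsP; exists j; rewrite eqxx.
Qed.

Lemma deg_degree (u : 'I_n) : deg n M u = degree e u.
Proof.
rewrite /deg /degree big_mkord -sum1_card [RHS]big_mkcond; apply: eq_bigr => w _.
by rewrite inE input_entry; case: (e u w).
Qed.

Lemma cnt_card (u w : 'I_n) : cnt n M u w = #|[set b | ~~ e u b & e w b]|.
Proof.
rewrite /cnt big_mkord -sum1_card [RHS]big_mkcond; apply: eq_bigr => b _.
by rewrite inE !input_entry; case: (e u b); case: (e w b).
Qed.

Lemma sep_separator (u w : 'I_n) : sep n M u w = (w \in separator e u).
Proof. by rewrite /sep inE input_entry cnt_card; case: (e u w) => //=; lia. Qed.

Lemma sep_size_card (u : 'I_n) : sep_size n M u = #|separator e u|.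
Proof.
rewrite /sep_size big_mkord -sum1_card [RHS]big_mkcond; apply: eq_bigr => w _.
by rewrite sep_separator; case: (w \in _).
Qed.

Lemma good_critical (u : 'I_n) : good n M u = critical e u.
Proof.
rewrite /good /critical sep_size_card deg_degree card_ord; congr (_ || _ && _).
rewrite /bad big_mkord sum_nat_eq0; apply/forallP/forallP => H w.
  apply/forallP => b; apply/implyP => uw; apply/implyP => ub.
  have := H w; rewrite input_entry (negPf uw) /= cnt_card cards_eq0 => /eqP/setP/(_ b).
  by rewrite !inE ub /= => ->.
rewrite input_entry; case: (boolP (e u w)) => //= uw.
rewrite cnt_card cards_eq0; apply/eqP/setP => b; rewrite !inE.
have /forallP/(_ b) := H w; rewrite uw /=.
by case: (e u b) => //= /negPf->.
Qed.

Lemma written_entry g (T : {set 'I_n}) :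
    (forall w : 'I_n, sep n M g w = (w \in T)) ->
  forall i : 'I_n, written n M g 0 (n * n + i) = (i \in ~: T).
Proof.
move=> sepT i; rewrite /written ifT; last by have := ltn_ord i; lia.
by rewrite addKn sepT inE.
Qed.

Lemma unsep_size_card g (T : {set 'I_n}) :
  (forall w : 'I_n, sep n M g w = (w \in T)) -> unsep_size n M g 0 = #|~: T|.
Proof.
move=> sepT; rewrite /unsep_size big_mkord -sum1_card [RHS]big_mkcond.
by apply: eq_bigr => w _; rewrite sepT inE; case: (w \in T).
Qed.

(** One form for both outcomes: without a critical vertex row 2n reads as zeros, and the complement
    of the empty separator is the whole vertex set. *)
Lemma choice_separator : exists2 T : {set 'I_n},
  forall w : 'I_n, sep n M (choice n M) w = (w \in T) &
  (exists2 u, critical e u & T = separator e u) \/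
  (forall u, ~~ critical e u) /\ T = set0.
Proof.
have : (exists2 u : 'I_n, good n M u & choice n M = u) \/
    (forall u : 'I_n, ~~ good n M u) /\ choice n M = n + n.
  rewrite /choice /choice_from.
  suff : forall r, all (fun u => u < n) r ->
    (exists2 u : 'I_n, good n M u & foldr (fun u g => if good n M u then u else g) (n + n) r = u) \/
    (forall u : 'I_n, nat_of_ord u \in r -> ~~ good n M u) /\
      foldr (fun u g => if good n M u then u else g) (n + n) r = n + n.
    case/(_ (iota 0 (n - 0))) => [|[u good_u ->]|[nogood ->]].
    - by apply/allP => u; rewrite mem_iota; lia.
    - by left; exists u.
    - by right; split=> // u; apply: nogood; rewrite mem_iota subn0 add0n /=.
  elim=> [_|k r IH /= /andP[lt_k /IH{}IH]] /=; first by right.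
  case: ifP => good_k; first by left; exists (Ordinal lt_k).
  case: IH => [|[nogood ->]]; [by left | right; split=> // u].
  by rewrite inE => /predU1P[->|/nogood//]; rewrite good_k.
case=> [[u good_u ->]|[nogood ->]].
  exists (separator e u) => [w|]; first exact: sep_separator.
  by left; exists u; rewrite // -good_critical.
exists set0 => [w|]; last by right; split=> // u; rewrite -good_critical.
by rewrite /sep input_out ?inE //; nia.
Qed.

Lemma high_degreeP :
  has (fun u => 2 < deg n M u) (iota 0 n) = [exists u : 'I_n, 2 < degree e u].
Proof.
apply/hasP/existsP => [[u]|[u]].
  rewrite mem_iota add0n => lt_u; have := deg_degree (Ordinal lt_u) => /= ->.
  by exists (Ordinal lt_u).
by rewrite -deg_degree; exists (nat_of_ord u); rewrite // mem_iota /=.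
Qed.

Lemma Hforce_cmd_correct :
  exists (t : nat) (s : state) (h : nat) (X : {set 'I_n}),
    [/\ exec (n ^ 4) Hforce_cmd (input e) t s, t <= 100 * n ^ 3, output s h X,
        Hforce_number e h & minimum_Hforce_set e X].
Proof.
(* For n = 3 the bound 3 n^2 equals n^3, hence the exponent 4. *)
have HW : 3 * n * n < n ^ 4 by rewrite !expnS expn0; nia.
have init : represents (input e) [:: n] M by split=> // -[].
have n3' : 3 <= #|'I_n| by rewrite card_ord.
have := run_Hforce n3 HW input_le1 input_out; rewrite high_degreeP.
case: ifP => [/existsP exv /(_ _ init)|/negbT noex /(_ _ init)] [t [s [ex_s le_t [sl sM]]]].
  have [T sepT Tspec] := choice_separator.
  have minT : minimum_Hforce_set e (~: T).
    case: Tspec => [[u crit ->]|[nocrit ->]]; first exact: critical_minimum.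
    by rewrite setC0; apply: no_critical_minimum.
  exists t, s, #|~: T|, (~: T); split=> //; last by case: minT.
  split; first by rewrite sl //= (unsep_size_card sepT).
  by move=> i; rewrite sM (written_entry sepT).
have n0 : 0 < n by lia.
have min1 := two_regular_minimum e_sym e_irr ore n3' (Ordinal n0).
have {}min1 : minimum_Hforce_set e [set Ordinal n0].
  by apply: min1 => u; rewrite leqNgt; move: noex; rewrite negb_exists => /forallP.
exists t, s, 1, [set Ordinal n0]; split=> //; last first.
  by case: min1 => _; rewrite cards1.
split=> [|i]; first by rewrite sl.
rewrite sM /= inE -val_eqE /= -{2}[n * n]addn0 eqn_add2l.
by case: eqP => // _; apply: input_out; lia.
Qed.

End Final.

Theorem theorem4p1 :
  exists (p : cmd) (w K : nat),
  forall (n : nat) (e : rel 'I_n),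
    3 <= n -> symmetric e -> irreflexive e -> OTG e ->
  exists (t : nat) (s : state) (h : nat) (X : {set 'I_n}),
    [/\ exec (n ^ w) p (input e) t s,
        t <= K * n ^ 3,
        output s h X,
        Hforce_number e h
      & minimum_Hforce_set e X].
Proof.
by exists Hforce_cmd, 4, 100 => n e *; apply: Hforce_cmd_correct.
Qed.
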